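(* For every integer $d\ge 2$ the quantities $T_+(d)$ and $T_-(d)$ are both positive and, as $d\to\infty$, $$T_+(d)\sim\frac{2\sqrt{2\pi}}{3}\,\frac{1}{\sqrt d}\left(\frac{\sqrt3}{2}\right)^d$$ and $$T_-(d)=O\left(\left(\frac{4\sqrt3}{9}\right)^d\right).$$
   Context: For an integer $d\ge 2$, $$T_+(d)=2\,\frac{(d-1)V_{d-1}}{dV_d}\int_0^1 dz\,(1-z^2)^{\frac{d-3}{2}}\left(1-\frac{\ln(1+2^dz^d)}{2^dz^d}\right),$$ $$T_-(d)=2\,\frac{(d-1)V_{d-1}}{dV_d}\int_0^\pi d\theta\,\sin(\theta)^{d-2}\int_{z(\theta)^d}^\infty du\left(F\!\left(\frac{\mathcal{L}(u^{1/d},\theta)}{V_d}\right)-F(u)\right).$$ Here $V_d=\frac{\pi^{d/2}}{\Gamma(d/2+1)}$ is the volume of the Euclidean unit ball in dimension $d$; for $z>0$, $F(z)=\frac1z\left(\frac1z\ln(1+z)-\frac1{1+z}\right)$; for $\theta\in[0,\pi]$, $z(\theta)=(2\cos\theta)_+$, i.e. $2\cos\theta$ if $\theta\in[0,\pi/2]$ and $0$ if $\theta\in[\pi/2,\pi]$; and $$\frac{\mathcal{L}(z,\theta)}{V_d}=z^d-\frac{V_{d-1}}{V_d}\left(\int_{\frac{1-z\cos\theta}{\sqrt{(1-z\cos\theta)^2+(z\sin\theta)^2}}}^{1}(1-x^2)^{\frac{d-1}{2}}\,dx+z^d\int_{-1}^{\frac{\cos\theta-z}{\sqrt{(\cos\theta-z)^2+(\sin\theta)^2}}}(1-x^2)^{\frac{d-1}{2}}\,dx\right).$$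 *)

(* Defs.v *)
From HB Require Import structures.
From mathcomp Require Export all_boot all_order all_algebra.
From mathcomp Require Export all_classical all_reals all_analysis.
Set Implicit Arguments.
Unset Strict Implicit.
Unset Printing Implicit Defensive.
Export Order.TTheory GRing.Theory Num.Theory.
Export numFieldNormedType.Exports.

Local Open Scope classical_set_scope.
Local Open Scope ring_scope.

Section Defs.
Variable R : realType.
Local Notation mu := (@lebesgue_measure R).

(* Euler's integral; meaningful for 0 < s. *)
Definition Gamma (s : R) : R :=
  \int[mu]_(t in `]0, +oo[) (t `^ (s - 1) * expR (- t)).

Definition ball_vol (d : nat) : R :=
  pi `^ (d%:R / 2) / Gamma (d%:R / 2 + 1).

Definition F (z : R) : R := z^-1 * (z^-1 * ln (1 + z) - (1 + z)^-1).

Definition zmin (theta : R) : R := Num.max (2 * cos theta) 0.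

(* The quotient L(z, theta) / V_d. *)
Definition lune_ratio (d : nat) (z theta : R) : R :=
  z ^+ d - ball_vol d.-1 / ball_vol d *
    (\int[mu]_(x in `[(1 - z * cos theta) /
          Num.sqrt ((1 - z * cos theta) ^+ 2 + (z * sin theta) ^+ 2), 1])
        ((1 - x ^+ 2) `^ ((d%:R - 1) / 2))
     + z ^+ d *
       \int[mu]_(x in `[-1, (cos theta - z) /
            Num.sqrt ((cos theta - z) ^+ 2 + sin theta ^+ 2)])
          ((1 - x ^+ 2) `^ ((d%:R - 1) / 2))).

Definition prefactor (d : nat) : R :=
  2 * ((d%:R - 1) * ball_vol d.-1 / (d%:R * ball_vol d)).

(* For d = 2 the weight is singular at z = 1; powR and the inverse are total,
   so the integrand has (irrelevant) finite values at z = 0 and z = 1. *)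
Definition Tplus (d : nat) : R :=
  prefactor d *
  \int[mu]_(z in `[0, 1])
    ((1 - z ^+ 2) `^ ((d%:R - 3) / 2) *
     (1 - ln (1 + 2 ^+ d * z ^+ d) / (2 ^+ d * z ^+ d))).

(* The iterated integral is taken in the extended reals, with a single
   projection at the very end: an infinite (or undefined) inner integral on a
   non-null set of angles is not silently replaced by 0. As fine maps both
   infinities to 0, positivity of Tplus and Tminus includes convergence. *)
Definition Tminus_integral (d : nat) : \bar R :=
  (\int[mu]_(theta in `[0%R, pi])
    ((sin theta ^+ (d - 2))%:E *
     \int[mu]_(u in `[(zmin theta ^+ d)%R, +oo[)
       (F (lune_ratio d (u `^ (d%:R^-1)) theta) - F u)%:E))%E.

Definition Tminus (d : nat) : R := prefactor d * fine (Tminus_integral d).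

End Defs.

(* Main.v *)
Require Import Defs.
From mathcomp Require Import measurable_realfun ring lra.
Set Implicit Arguments.
Unset Strict Implicit.
Unset Printing Implicit Defensive.
Local Open Scope classical_set_scope.
Local Open Scope ring_scope.

(** Write [W_d] for the integral of [cos ^ d] over [[-pi/2, pi/2]]. Slicing the
    unit ball gives [V_(d-1) / V_d = 1 / W_d] ([ball_vol_ratio]), and Wallis'
    identity [d * W_(d-1) * W_d = 2 * pi] ([wallis_mulS]) gives
    [sqrt d * W_d --> sqrt (2 * pi)]; so the prefactor of both quantities is
    [2 * (d - 1) / (d * W_d)] and grows like [sqrt d].

    The quantity [T_+]. With [logw v = 1 - ln (1 + v) / v], which lies between
    [0] and [min v 1], the integrand is [(1 - z^2)^((d-3)/2) * logw ((2 z)^d)].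
    It increases exponentially up to [z = 1/2], where [(2 z)^d] passes [1], and
    decreases exponentially afterwards. The substitution [2 z = x^(3/d)] blows
    up that point ([Tplus_rescaled]): it takes out the factor
    [3 / (2 d) * (3/4)^((d-3)/2)] and leaves an integral over the half-line
    whose integrand [rescaled d] tends to [x^-2 * logw (x^3)]
    ([rescaled_cvg]) and is dominated for [12 <= d] by a multiple of
    [(1 + x)^(-3/2)] ([rescaled_dom]). An explicit primitive evaluates the
    limit integral to [pi / (2 * sqrt 3)] ([limit_integral]), and the constant
    follows. The exponent [3] in the substitution makes this primitive
    elementary: by parts, the limit integrand becomes [x / (1 + x^3)].

    The quantity [T_-]. In a plane triangle with sides [1] and [z] enclosing
    the angle [theta], the balls around the ends of the third side which pass
    through the common vertex have radii [1] and [z]; [L(z, theta) / V_d] is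
    [z^d - M], where [M] is the normalized volume of their intersection, and
    the inner integrand is [F (u - M) - F u] with [u = z^d]
    ([lune_ratioE]). For [z >= 2 cos theta] the third side has length at least
    [1]. The intersection is strictly contained in the ball of radius [z]
    ([lens_lt]) and [F] is decreasing, so the integrand is nonnegative, and it
    is bounded below by a positive constant on a rectangle: [T_-] is positive
    once it is finite. For the upper bound, the two balls meet in a disc of
    radius at most [sqrt z * cos (theta / 2)] ([height_le]), and a cap smaller
    than a half ball fits into the half ball over its base; hence
    [M <= 3/2 * sqrt u * cos (theta / 2) ^ d] ([lens_le]). As [F] is Lipschitz,
    with constant [O (u^-2)] for large [u], the inner integrand is at most a
    constant times [cos (theta / 2) ^ d * (1 + u)^(-3/2)] ([gap_le]). What
    remains is the integral of [sin theta ^ (d-2) * cos (theta / 2) ^ d]. With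
    [x = sin (theta / 2)] the product [sin theta * cos (theta / 2)] is
    [2 * x * (1 - x^2)], whose maximum [4 * sqrt 3 / 9] at [x = 1 / sqrt 3] is
    the announced rate. The growth [sqrt d] of the prefactor has to be
    compensated: [cubic_le] bounds the cubic by
    [rate / (1 + 3 * (x - 1 / sqrt 3)^2)], Bernoulli's inequality turns the
    power into a Cauchy density of width [1 / sqrt d], and the primitive of
    that density is an arc tangent ([trig_integral]). *)

(** * Integrals of continuous functions, differentiation and continuity rules *)

Section Tools.
Variable R : realType.
Local Notation mu := (@lebesgue_measure R).

(** Integrals of nonnegative functions are suprema over simple functions below
    them, which makes them monotone without any measurability. This spares the
    measurability in [theta] of the inner integral of [Tminus_integral]. *)
Lemma le_integral_extension (D E : set R) (f g : R -> \bar R) :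
  (forall x, D x -> E x) -> (forall x, D x -> (0 <= f x)%E) ->
  (forall x, E x -> (0 <= g x)%E) -> (forall x, D x -> (f x <= g x)%E) ->
  (\int[mu]_(x in D) f x <= \int[mu]_(x in E) g x)%E.
Proof.
move=> DE f0 g0 fg; rewrite !ge0_integralE//.
apply: le_ereal_sup => _ [h /= hf <-]; exists h => //= x.
apply: (le_trans (hf x)); rewrite !patchE.
case: ifPn => [|_]; last first.
  by case: ifPn => [/set_mem/g0|].
by move=> /set_mem Dx; rewrite mem_set; [exact: fg|exact: DE].
Qed.

Lemma continuous_integrable (f : R -> R) (a b : R) : continuous f ->
  mu.-integrable `[a, b] (EFin \o f).
Proof.
move=> cf; apply: continuous_compact_integrable; first exact: segment_compact.
exact: continuous_subspaceT.
Qed.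

(** A definition, so that instance resolution does not attempt the hypothesis
    of the rules below when they are used for rewriting. *)
Definition antiderivative (P : R -> Prop) (F f : R -> R) :=
  forall x, P x -> is_derive x 1 F (f x).

Lemma continuous_emeasurable (D : set R) (f : R -> R) : continuous f ->
  measurable D -> measurable_fun D (EFin \o f).
Proof.
move=> cf mD; apply/measurable_EFinP; apply: measurable_funTS.
exact: continuous_measurable_fun.
Qed.

Lemma FTC_eint (f F : R -> R) (a b : R) : a <= b -> continuous f ->
  {for a, continuous F} -> {for b, continuous F} ->
  antiderivative (fun x => a < x < b) F f ->
  (\int[mu]_(x in `[a, b]) (f x)%:E = (F b - F a)%:E)%E.
Proof.
rewrite le_eqVlt => /predU1P[<-|ab] cf cFa cFb dF.
  by rewrite set_itv1 integral_set1 subrr.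
rewrite (@continuous_FTC2 _ f F)//.
- exact: continuous_subspaceT.
- split => [x|//|//].
  + by rewrite in_itv/= => /dF [].
  + exact/cvg_at_right_filter/cFa.
  + exact/cvg_at_left_filter/cFb.
- by move=> x; rewrite in_itv/= => /dF H; rewrite derive1E derive_val.
Qed.

Lemma FTC_int (f F : R -> R) (a b : R) : a <= b -> continuous f ->
  {for a, continuous F} -> {for b, continuous F} ->
  antiderivative (fun x => a < x < b) F f ->
  \int[mu]_(x in `[a, b]) f x = F b - F a.
Proof. by move=> *; rewrite /Rintegral (@FTC_eint f F). Qed.

Lemma FTC_inty (f F : R -> R) (a l : R) : (forall x, a <= x -> 0 <= f x) ->
  continuous f -> {for a, continuous F} ->
  F x @[x --> +oo] --> l -> antiderivative (fun x => a < x) F f ->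
  (\int[mu]_(x in `[a, +oo[) (f x)%:E = (l - F a)%:E)%E.
Proof.
move=> f0 cf cF Fl dF.
rewrite (@ge0_continuous_FTC2y _ f F a l)//.
- exact: continuous_subspaceT.
- by move=> x /dF [].
- exact/cvg_at_right_filter/cF.
- by move=> x; rewrite in_itv/= andbT => /dF H; rewrite derive1E derive_val.
Qed.

Lemma integral_cst_itv (a b c : R) : a <= b ->
  (\int[mu]_(x in `[a, b]) c%:E = (c * (b - a))%:E)%E.
Proof.
rewrite le_eqVlt => /predU1P[<-|ab].
  by rewrite set_itv1 integral_set1 subrr mulr0.
by rewrite integral_cst//= lebesgue_measure_itv/= lte_fin ab -EFinB -EFinM.
Qed.

Lemma is_derive_continuous (F : R -> R) (x a : R) :
  is_derive x 1 F a -> {for x, continuous F}.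
Proof.
by move=> dF; apply: differentiable_continuous; apply/derivable1_diffP; have [] := dF.
Qed.

Definition prim (f : R -> R) (a x : R) := \int[mu]_(t in `[a, x]) f t.

(** Basing the primitive strictly to the left of the interval of interest makes
    it differentiable at both ends of that interval; this is why the base points
    [-1] and [-2] occur below. *)
Lemma prim_is_derive (f : R -> R) (a x : R) : continuous f -> a < x ->
  is_derive x 1 (prim f a) (f x).
Proof.
move=> cf ax.
have xx : x < x + 1 by rewrite ltrDl.
have [] := @continuous_FTC1_closed _ f a x _ xx
  (continuous_integrable a (x + 1) cf) ax (cf x).
by rewrite -/(prim f a) derive1E => d1 d2; apply: DeriveDef.
Qed.

Lemma prim_add (f : R -> R) (a x y : R) : continuous f -> a <= x -> x <= y ->
  \int[mu]_(t in `[a, y]) f t = prim f a x + \int[mu]_(t in `[x, y]) f t.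
Proof.
move=> cf ax xy.
have H := @Rintegral_itvB R f (BLeft a) (BRight y) x (continuous_integrable a y cf).
rewrite -(@Rintegral_itv_obnd_cbnd _ x); last first.
  by apply: integrableS (continuous_integrable x y cf) => //; exact: subset_itv_oc_cc.
by rewrite -H ?bnd_simp// /prim addrCA subrr addr0.
Qed.

(** For nonnegative exponents this extension of the real power is continuous on
    the whole line, so that integrands involving it are as well. *)
Definition powRpos (p y : R) := Num.max y 0 `^ p.

Lemma powRposE (p y : R) : 0 <= y -> powRpos p y = y `^ p.
Proof. by move=> y0; rewrite /powRpos max_l. Qed.

Lemma powRpos_ge0 (p y : R) : 0 <= powRpos p y.
Proof. exact: powR_ge0. Qed.

Lemma powRpos0 (p : R) : 0 < p -> powRpos p 0 = 0.
Proof. by move=> p0; rewrite powRposE// powR0// gt_eqF. Qed.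

Lemma continuous_powRpos (p : R) : 0 <= p -> continuous (powRpos p).
Proof.
rewrite le_eqVlt => /predU1P[<-|p0] y.
  rewrite (_ : powRpos 0 = fun=> 1); first exact: cvg_cst.
  by apply/funext => z; rewrite /powRpos powRr0.
have cm : continuous (fun y : R => Num.max y 0).
  by move=> z; apply: continuous_max; [exact: cvg_id|exact: cvg_cst].
have [y0|y0|->] := ltgtP y 0.
- rewrite /continuous_at /powRpos (max_r (ltW y0)) powR0 ?gt_eqF//.
  apply: cvg_near_cst; near=> z; rewrite max_r ?powR0 ?gt_eqF//.
  by apply: ltW; near: z; exact: lt_nbhsl.
- rewrite (_ : powRpos p = (fun t : R => t `^ p) \o (fun y : R => Num.max y 0))//.
  apply: continuous_comp.
    exact: cm.
  apply: differentiable_continuous; apply/derivable1_diffP.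
  by apply: derivable_powR; rewrite in_itv/= max_l ?(ltW y0)// y0.
- suff : powRpos p z @[z --> (0 : R)] --> (0 : R).
    by rewrite /continuous_at {3}/powRpos maxxx powR0 ?gt_eqF.
  apply/cvgrPdist_le => e e0.
  have e1 : 0 < e `^ p^-1 by exact: powR_gt0.
  near=> z.
  rewrite sub0r normrN ger0_norm ?powR_ge0// /powRpos.
  rewrite [X in _ <= X](_ : e = (e `^ p^-1) `^ p); last first.
    by rewrite -powRrM mulVf ?gt_eqF// powRr1// ltW.
  apply: ge0_ler_powR; rewrite ?nnegrE ?le_max ?lexx ?orbT ?(ltW p0) ?(ltW e1)//.
  rewrite ge_max (ltW e1) andbT.
  by apply: ltW; near: z; exact: lt_nbhsl.
Unshelve. all: by end_near. Qed.

Section DerivativeRules.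
Variables (f g : R -> R) (x a b : R).
Hypotheses (df : is_derive x 1 f a) (dg : is_derive x 1 g b).

Lemma derD : is_derive x 1 (fun t => f t + g t) (a + b).
Proof. exact: is_deriveD. Qed.

Lemma derB : is_derive x 1 (fun t => f t - g t) (a - b).
Proof. exact: is_deriveB. Qed.

Lemma derN : is_derive x 1 (fun t => - f t) (- a).
Proof. exact: is_deriveN. Qed.

Lemma derM : is_derive x 1 (fun t => f t * g t) (f x * b + g x * a).
Proof. exact: is_deriveM. Qed.

Lemma derX n : is_derive x 1 (fun t => f t ^+ n) (n%:R * f x ^+ n.-1 * a).
Proof.
elim: n => [|n IH].
  rewrite !mul0r (_ : (fun t => f t ^+ 0) = cst 1); first exact: is_derive_cst.
  by apply/funext => t; rewrite expr0.
rewrite (_ : (fun t => f t ^+ n.+1) = f * (fun t => f t ^+ n)); last first.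
  by apply/funext => t; rewrite exprS.
apply: (is_derive_eq (is_deriveM df IH)).
case: n {IH} => [|n] /=; rewrite /GRing.scale/= ?expr0; first by ring.
by rewrite exprS -(natr1 n.+1); ring.
Qed.

Lemma derV : f x != 0 -> is_derive x 1 (fun t => (f t)^-1) (- (f x) ^- 2 * a).
Proof. by move=> fx; exact: is_deriveV. Qed.

Lemma der_comp (h : R -> R) c : is_derive (f x) 1 h c ->
  is_derive x 1 (fun t => h (f t)) (c * a).
Proof. by move=> dh; have := @is_derive1_comp _ h f x c a dh df; rewrite mulrC. Qed.

Lemma der_sin : is_derive x 1 (fun t => sin (f t)) (cos (f x) * a).
Proof. exact: der_comp. Qed.

Lemma der_cos : is_derive x 1 (fun t => cos (f t)) (- sin (f x) * a).
Proof. exact: der_comp. Qed.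

Lemma der_expR : is_derive x 1 (fun t => expR (f t)) (expR (f x) * a).
Proof. exact: der_comp. Qed.

Lemma der_atan : is_derive x 1 (fun t => atan (f t)) ((1 + f x ^+ 2)^-1 * a).
Proof. exact: der_comp. Qed.

Lemma der_ln : 0 < f x -> is_derive x 1 (fun t => ln (f t)) ((f x)^-1 * a).
Proof. by move=> fx; apply: der_comp; exact: is_derive1_ln. Qed.

Lemma der_sqrt : 0 < f x ->
  is_derive x 1 (fun t => Num.sqrt (f t)) ((2 * Num.sqrt (f x))^-1 * a).
Proof. by move=> fx; apply: der_comp; exact: is_derive1_sqrt. Qed.

Lemma der_powR p : 0 < f x ->
  is_derive x 1 (fun t => f t `^ p) (p * f x `^ (p - 1) * a).
Proof. by move=> fx; apply: (@der_comp (fun t => t `^ p)); exact: is_derive1_powR. Qed.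

Lemma der_cst (c : R) : is_derive x 1 (fun=> c) 0.
Proof. exact: is_derive_cst. Qed.

Lemma der_id : is_derive x 1 (fun t : R => t) 1.
Proof. exact: is_derive_id. Qed.

End DerivativeRules.

Lemma cont_at (f : R -> R) (x : R) : continuous f -> {for x, continuous f}.
Proof. exact. Qed.

Section ContinuityRules.
Variables (f g : R -> R).
Hypotheses (cf : continuous f) (cg : continuous g).

Lemma contD : continuous (fun t => f t + g t).
Proof. by move=> x; apply: cvgD; [exact: cf|exact: cg]. Qed.

Lemma contN : continuous (fun t => - f t).
Proof. by move=> x; apply: cvgN; exact: cf. Qed.

Lemma contM : continuous (fun t => f t * g t).
Proof. by move=> x; apply: cvgM; [exact: cf|exact: cg]. Qed.

Lemma cont_comp (h : R -> R) : continuous h -> continuous (fun t => h (f t)).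
Proof. by move=> ch x; apply: continuous_comp; [exact: cf|exact: ch]. Qed.

Lemma contX n : continuous (fun t => f t ^+ n).
Proof. by apply: (@cont_comp (fun t => t ^+ n)); exact: exprn_continuous. Qed.

Lemma contV : (forall x, f x != 0) -> continuous (fun t => (f t)^-1).
Proof. by move=> f0 x; apply: cvgV; [exact: f0|exact: cf]. Qed.

Lemma cont_id : continuous (fun t : R => t).
Proof. by move=> x; exact: cvg_id. Qed.

Lemma cont_cst (c : R) : continuous (fun _ : R => c).
Proof. by move=> x; exact: cvg_cst. Qed.

End ContinuityRules.

End Tools.

(* Instance resolution is switched off: it would see through exponentiation
   and close the subgoals with unusable values. *)
Ltac der1 := lazymatch goal with
  | |- is_derive _ _ (fun _ => ?c) _ => notypeclasses refine (der_cst _ _)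
  | |- is_derive _ _ (fun t => t) _ => notypeclasses refine (der_id _)
  | |- is_derive _ _ (fun t => - @?f t) _ =>
      notypeclasses refine (@derN _ f _ _ _)
  | |- is_derive _ _ (fun t => @?f t - @?g t) _ =>
      notypeclasses refine (@derB _ f g _ _ _ _ _)
  | |- is_derive _ _ (fun t => @?f t + @?g t) _ =>
      notypeclasses refine (@derD _ f g _ _ _ _ _)
  | |- is_derive _ _ (fun t => @?f t * @?g t) _ =>
      notypeclasses refine (@derM _ f g _ _ _ _ _)
  | |- is_derive _ _ (fun t => @?f t ^+ ?n) _ =>
      notypeclasses refine (@derX _ f _ _ _ n)
  | |- is_derive _ _ (fun t => (@?f t)^-1) _ =>
      notypeclasses refine (@derV _ f _ _ _ _)
  | |- is_derive _ _ (fun t => sin (@?f t)) _ =>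
      notypeclasses refine (@der_sin _ f _ _ _)
  | |- is_derive _ _ (fun t => cos (@?f t)) _ =>
      notypeclasses refine (@der_cos _ f _ _ _)
  | |- is_derive _ _ (fun t => expR (@?f t)) _ =>
      notypeclasses refine (@der_expR _ f _ _ _)
  | |- is_derive _ _ (fun t => atan (@?f t)) _ =>
      notypeclasses refine (@der_atan _ f _ _ _)
  | |- is_derive _ _ (fun t => ln (@?f t)) _ =>
      notypeclasses refine (@der_ln _ f _ _ _ _)
  | |- is_derive _ _ (fun t => Num.sqrt (@?f t)) _ =>
      notypeclasses refine (@der_sqrt _ f _ _ _ _)
  | |- is_derive _ _ (fun t => (@?f t) `^ ?p) _ =>
      notypeclasses refine (@der_powR _ f _ _ _ p _)
  end; cbv beta.
Ltac der := repeat der1.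
Ltac derive_eq := notypeclasses refine (is_derive_eq _ _).
Ltac derive_to := notypeclasses refine (is_derive_eq _ _); [der|cbv beta].
Ltac cont1 := lazymatch goal with
  | |- continuous (fun _ => ?c) => apply: cont_cst
  | |- continuous (fun t => t) => apply: cont_id
  | |- continuous (fun t => - @?f t) => apply: (@contN _ f)
  | |- continuous (fun t => @?f t + @?g t) => apply: (@contD _ f g)
  | |- continuous (fun t => @?f t * @?g t) => apply: (@contM _ f g)
  | |- continuous (fun t => @?f t ^+ ?n) => apply: (@contX _ f)
  | |- continuous (fun t => (@?f t)^-1) => apply: (@contV _ f)
  | |- continuous (fun t => sin (@?f t)) =>
      apply: (@cont_comp _ f _ sin); last exact: continuous_sin
  | |- continuous (fun t => cos (@?f t)) =>
      apply: (@cont_comp _ f _ cos); last exact: continuous_cos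
  | |- continuous (fun t => expR (@?f t)) =>
      apply: (@cont_comp _ f _ expR); last exact: continuous_expR
  | |- continuous (fun t => atan (@?f t)) =>
      apply: (@cont_comp _ f _ atan); last exact: continuous_atan
  | |- continuous (fun t => Num.sqrt (@?f t)) =>
      apply: (@cont_comp _ f _ Num.sqrt); last exact: sqrt_continuous
  | |- continuous (fun t => powRpos ?p (@?f t)) =>
      apply: (@cont_comp _ f _ (powRpos p)); last apply: continuous_powRpos
  end; cbv beta.
Ltac cont := repeat cont1.

(** * Powers of the cosine and the Wallis integrals *)

Section Wallis.
Variable R : realType.
Local Notation mu := (@lebesgue_measure R).
Local Notation hpi := (pi / 2 : R).

Definition wallis (d : nat) : R := \int[mu]_(t in `[- hpi, hpi]) cos t ^+ d.

Let hpi_le : - hpi <= hpi.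
Proof. by have := pi_gt0 R; lra. Qed.

Lemma wallis0 : wallis 0 = pi.
Proof.
rewrite /wallis (@FTC_int _ (fun t => cos t ^+ 0) id)//.
- by rewrite opprK -splitr.
- by cont.
- by move=> x _; rewrite expr0; exact: der_id.
Qed.

Lemma wallis1 : wallis 1 = 2.
Proof.
rewrite /wallis (@FTC_int _ (fun t => cos t ^+ 1) sin)//.
- by rewrite sinN sin_pihalf opprK.
- by cont.
- exact: continuous_sin.
- exact: continuous_sin.
- by move=> x _; rewrite expr1; exact: is_derive_sin.
Qed.

(** Integration by parts: [sin * cos ^ d.+1] vanishes at both ends, and its
    derivative is the difference of the two integrands. *)
Lemma wallisS2 d : d.+2%:R * wallis d.+2 = d.+1%:R * wallis d.
Proof.
have cc n : continuous (fun t : R => cos t ^+ n) by cont.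
have H : \int[mu]_(t in `[- hpi, hpi])
   (d.+2%:R * cos t ^+ d.+2 - d.+1%:R * cos t ^+ d) = 0.
  rewrite (@FTC_int R (fun t => d.+2%:R * cos t ^+ d.+2 - d.+1%:R * cos t ^+ d)
    (fun t => sin t * cos t ^+ d.+1))//.
  - by rewrite cosN cos_pihalf !exprS !mul0r !mulr0 subrr.
  - by cont.
  - by apply: cont_at; cont.
  - by apply: cont_at; cont.
  - move=> x _; derive_to; rewrite /= !exprS.
    have -> : d.+2%:R = d.+1%:R + 1 :> R by rewrite natr1.
    ring: (sin2cos2 x).
apply/eqP; rewrite -subr_eq0; apply/eqP.
have int k n : mu.-integrable `[- hpi, hpi]
    (EFin \o (fun t : R => k%:R * cos t ^+ n)).
  by apply: continuous_integrable; cont.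
rewrite -H RintegralB//.
by rewrite !RintegralZl//; apply: continuous_integrable; cont.
Qed.

Lemma wallis_gt0 d : 0 < wallis d.
Proof.
suff: 0 < wallis d /\ 0 < wallis d.+1 by case.
elim: d => [|d [IH0 IH1]]; first by rewrite wallis0 wallis1 pi_gt0.
split=> //; have := wallisS2 d => H.
have : 0 < d.+2%:R * wallis d.+2 by rewrite H mulr_gt0.
by rewrite pmulr_rgt0.
Qed.

(** By [wallisS2] the left-hand side does not depend on [d]. *)
Lemma wallis_mulS d : d.+1%:R * (wallis d * wallis d.+1) = 2 * pi.
Proof.
elim: d => [|d IH]; first by rewrite wallis0 wallis1; ring.
by rewrite mulrCA wallisS2 -IH; ring.
Qed.

Lemma wallis_le d : wallis d.+1 <= wallis d.
Proof.
apply: le_Rintegral => //; try by apply: continuous_integrable; cont.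
move=> t /=; rewrite in_itv/= => /andP[t1 t2].
have c0 : 0 <= cos t by apply: cos_ge0_pihalf; rewrite t1 t2.
by rewrite exprS ler_piMl ?exprn_ge0// cos_le1.
Qed.

Lemma wallis_sqr_ge d : 2 * pi / d.+1%:R <= wallis d ^+ 2.
Proof.
rewrite ler_pdivrMr// -(wallis_mulS d) mulrC ler_pM2r// expr2 ler_pM2l//.
  exact: wallis_le.
exact: wallis_gt0.
Qed.

Lemma wallis_sqr_le d : wallis d.+1 ^+ 2 <= 2 * pi / d.+1%:R.
Proof.
rewrite ler_pdivlMr// -(wallis_mulS d) mulrC ler_pM2l// expr2 ler_pM2r//.
  exact: wallis_le.
exact: wallis_gt0.
Qed.

(** The substitution [x = sin t]. *)
Lemma wallis_cap d : (2 <= d)%N ->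
  \int[mu]_(x in `[-1, 1]) powRpos ((d%:R - 1) / 2) (1 - x ^+ 2) = wallis d.
Proof.
move=> d2; set p : R := (d%:R - 1) / 2.
have d2' : 2 <= d%:R :> R by rewrite ler_nat.
have p0 : 0 < p by rewrite /p; lra.
have dsin : derive1 (@sin R) = cos.
  by apply/funext => y; rewrite derive1E derive_val.
rewrite /wallis /Rintegral.
have := (@integration_by_substitution_increasing R sin
   (fun x => powRpos p (1 - x ^+ 2)) (- hpi) hpi).
rewrite sinN sin_pihalf => ->//.
- congr fine; apply: eq_integral => t; rewrite inE/= in_itv/= => /andP[t1 t2].
  have c0 : 0 <= cos t by apply: cos_ge0_pihalf; rewrite t1 t2.
  rewrite /GRing.mul/= derive1E derive_val -cos2sin2 powRposE ?sqr_ge0//.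
  congr EFin.
  have [->|cn0] := eqVneq (cos t) 0.
    by rewrite mulr0; case: (d) d2 => // n _; rewrite exprS mul0r.
  have cp : 0 < cos t by rewrite lt_neqAle eq_sym cn0.
  rewrite -powR_mulrn// -powRrM -[X in _ * X = _]powRr1// -powRD.
    by rewrite -powR_mulrn//; congr (_ `^ _); rewrite /p; field.
  by rewrite cn0 implybT.
- move=> x y; rewrite !in_itv/= => xI yI xy; rewrite ltr_sin// in_itv/=.
- move=> x _; rewrite dsin; exact: continuous_cos.
- apply/cvg_ex; exists (cos (- hpi)); apply/cvg_at_right_filter.
  rewrite dsin; exact: continuous_cos.
- apply/cvg_ex; exists (cos hpi); apply/cvg_at_left_filter.
  rewrite dsin; exact: continuous_cos.
- split => [x _||].
  + exact: derivable_sin.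
  + exact/cvg_at_right_filter/continuous_sin.
  + exact/cvg_at_left_filter/continuous_sin.
- by apply: continuous_subspaceT; cont; exact: ltW.
Qed.

End Wallis.

(** * The Gamma function at half-integers and volumes of balls *)

Section GammaHalf.
Variable R : realType.
Local Notation mu := (@lebesgue_measure R).

Lemma cvgV_infty : (x^-1 : R) @[x --> +oo] --> (0 : R).
Proof.
have := @gtr0_cvgV0 R _ (+oo : set_system R) _ id.
by case; [near=> x; rewrite /=; near: x; exact: nbhs_pinfty_gt|move=> _; apply; exact: cvg_id].
Unshelve. all: by end_near. Qed.

(** The exponential beats a power: [x^q * exp (- x)] is the [q]-th power of
    [x * exp (- x / q)], and [exp y >= y^2 / 2] bounds the latter by
    [2 * q^2 / x]. *)
Lemma powR_expRN_cvg0 (q : R) : 0 < q ->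
  powRpos q x * expR (- x) @[x --> +oo] --> 0.
Proof.
move=> q0.
apply: (@squeeze_cvgr _ _ _ _ (fun=> 0) (fun x => powRpos q (2 * q ^+ 2 * x^-1))).
- near=> x.
  have x0 : 0 < x by near: x; exact: nbhs_pinfty_gt.
  rewrite mulr_ge0 ?powRpos_ge0 ?expR_ge0//=.
  have c0 : 0 <= 2 * q ^+ 2 * x^-1.
    by rewrite mulr_ge0 ?invr_ge0 ?(ltW x0)// mulr_ge0 ?exprn_ge0 ?(ltW q0).
  rewrite (powRposE q (ltW x0)) (powRposE q c0).
  have -> : expR (- x) = expR (- (x / q)) `^ q.
    by rewrite -expRM mulNr divfK ?gt_eqF.
  rewrite -powRM ?expR_ge0 ?(ltW x0)//.
  apply: ge0_ler_powR; rewrite ?nnegrE ?c0 ?mulr_ge0 ?expR_ge0 ?(ltW x0) ?(ltW q0)//.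
  rewrite expRN ler_pdivrMr ?expR_gt0//.
  have y0 : 0 < x / q by rewrite divr_gt0.
  have := @expR_ge1Dxn R (x / q) 1 (ltW y0).
  rewrite (_ : 2`!%:R = 2)// => H.
  have H1 : (x / q) ^+ 2 / 2 <= expR (x / q) by apply: le_trans H; rewrite lerDr.
  apply: le_trans (_ : 2 * q ^+ 2 / x * ((x / q) ^+ 2 / 2) <= _).
    rewrite le_eqVlt; apply/orP; left; apply/eqP; field.
    by rewrite !gt_eqF.
  by rewrite ler_pM2l// mulr_gt0 ?invr_gt0// mulr_gt0// exprn_gt0.
- exact: cvg_cst.
- have c : continuous (fun y => powRpos q (2 * q ^+ 2 * y)).
    by cont; exact: ltW.
  have := cvg_comp _ _ cvgV_infty (c 0).
  by rewrite mulr0 powRpos0.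
Unshelve. all: by end_near. Qed.

(** The integrand of Euler's integral at [p + 1], extended by [powRpos]. Its
    primitives based at [0] are the incomplete Gamma functions, whose limits
    at infinity are computed below for half-integral [p] only. *)
Definition gamma_integrand (p t : R) := powRpos p t * expR (- t).

Lemma gamma_integrand_cont p : 0 <= p -> continuous (gamma_integrand p).
Proof. by move=> p0; rewrite /gamma_integrand; cont. Qed.

Lemma prim_cont (f : R -> R) (a x : R) : continuous f -> a < x ->
  {for x, continuous (prim f a)}.
Proof. by move=> cf ax; apply: is_derive_continuous (prim_is_derive cf ax). Qed.

Lemma Gamma_cvg (p l : R) : 0 <= p ->
  prim (gamma_integrand p) 0 t @[t --> +oo] --> l -> Gamma (p + 1) = l.
Proof.
move=> p0 H; have cg := gamma_integrand_cont p0.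
have N1 : (-1 : R) < 0 by rewrite ltrN10.
rewrite /Gamma /Rintegral.
rewrite (@eq_integral _ _ R (@lebesgue_measure R) _ (EFin \o gamma_integrand p)); last first.
  move=> t; rewrite inE/= in_itv/= andbT => t0.
  by rewrite /gamma_integrand powRposE ?ltW// addrK.
rewrite integral_itv_obnd_cbnd//=; last exact: continuous_emeasurable.
rewrite (@FTC_inty R (gamma_integrand p) (prim (gamma_integrand p) (-1)) 0
  (prim (gamma_integrand p) (-1) 0 + l)).
- by rewrite /= addrC addKr.
- by move=> x _; rewrite mulr_ge0 ?powRpos_ge0 ?expR_ge0.
- exact: cg.
- exact: prim_cont.
- apply: cvg_trans (cvgD (cvg_cst _) H).
  apply: near_eq_cvg; near=> t.
  have t0 : 0 <= t by near: t; exact: nbhs_pinfty_ge.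
  by rewrite /= [RHS]/prim (@prim_add R (gamma_integrand p) (-1) 0 t) ?(ltW N1).
- by move=> x x0; apply: prim_is_derive => //; exact: lt_trans x0.
Unshelve. all: by end_near. Qed.

(** Integration by parts; the boundary term [t^(p+1) * exp (- t)] vanishes at
    [0] and at infinity. *)
Lemma prim_gammaS (p l : R) : 0 <= p ->
  prim (gamma_integrand p) 0 t @[t --> +oo] --> l ->
  prim (gamma_integrand (p + 1)) 0 t @[t --> +oo] --> (p + 1) * l.
Proof.
move=> p0 H; have cg := gamma_integrand_cont p0.
have q0 : 0 < p + 1 by rewrite ltr_wpDl.
have cg1 := gamma_integrand_cont (ltW q0).
have N1 : (-1 : R) < 0 by rewrite ltrN10.
have Hl : (p + 1) * prim (gamma_integrand p) 0 t - gamma_integrand (p + 1) t @[t --> +oo]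
    --> (p + 1) * l.
  rewrite -[X in _ --> X]subr0; apply: cvgB; last exact: powR_expRN_cvg0.
  by apply: cvgM => //; exact: cvg_cst.
apply: cvg_trans Hl; apply: near_eq_cvg; near=> t.
have t0 : 0 < t by near: t; exact: nbhs_pinfty_gt.
rewrite [RHS]/prim.
have cF x : -1 < x -> {for x, continuous
    (fun x => (p + 1) * prim (gamma_integrand p) (-1) x - gamma_integrand (p + 1) x)}.
  move=> x1; apply: cvgB; last exact: cg1.
  by apply: cvgM; [exact: cvg_cst|exact: prim_cont].
rewrite (@FTC_int R _
  (fun x => (p + 1) * prim (gamma_integrand p) (-1) x - gamma_integrand (p + 1) x)).
- rewrite {2}/prim (@prim_add R (gamma_integrand p) (-1) 0 t) ?ltW//.
  rewrite /gamma_integrand powRpos0// -/(prim _ _ _).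
  by rewrite -/(gamma_integrand p) -/(prim (gamma_integrand p) 0 t); ring.
- exact: ltW.
- exact: cg1.
- exact: cF.
- by apply: cF; exact: lt_trans t0.
- move=> x /andP[x0 xt].
  derive_eq.
    notypeclasses refine (derB _ _).
      notypeclasses refine (derM _ _); first exact: der_cst.
      by apply: prim_is_derive => //; exact: lt_trans x0.
    rewrite /gamma_integrand /powRpos.
    apply: (@near_eq_is_derive _ _ _ (fun y => y `^ (p + 1) * expR (- y))).
      near=> y.
      have y0 : 0 < y by near: y; exact: lt_nbhsr.
      by rewrite max_l// ltW.
    by der.
  rewrite /gamma_integrand !powRposE ?ltW// addrK; ring.
Unshelve. all: by end_near. Qed.

Lemma prim_gamma0 : prim (gamma_integrand 0) 0 t @[t --> +oo] --> (1 : R).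
Proof.
have H : 1 - expR (- t) @[t --> +oo] --> (1 - 0 : R).
  by apply: cvgB; [exact: cvg_cst|exact: cvgr_expR].
rewrite subr0 in H.
apply: cvg_trans H; apply: near_eq_cvg; near=> t.
rewrite /prim (@FTC_int R _ (fun x => - expR (- x))).
- by rewrite oppr0 expR0; ring.
- by near: t; exact: nbhs_pinfty_ge.
- exact: gamma_integrand_cont.
- by apply: cont_at; cont.
- by apply: cont_at; cont.
- by move=> x _; derive_to; rewrite /gamma_integrand /powRpos powRr0; ring.
Unshelve. all: by end_near. Qed.

Lemma prim_gauss : prim gauss_fun 0 x @[x --> +oo] --> Num.sqrt (pi : R) / 2.
Proof.
have : Num.sqrt (prim (@gauss_fun R) 0 x ^+ 2) @[x --> +oo] --> Num.sqrt (pi / 4 : R).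
  apply: continuous_cvg; first exact: sqrt_continuous.
  exact: gauss_integral_proof.cvg_integral0_gauss_sqr.
rewrite sqrtrM ?pi_ge0// sqrtrV// (_ : 4 = 2 ^+ 2); last by rewrite expr2 -natrM.
rewrite sqrtr_sqr ger0_norm//; apply: cvg_trans.
apply: near_eq_cvg; near=> x.
rewrite sqrtr_sqr ger0_norm//; exact: gauss_integral_proof.integral0_gauss_ge0.
Unshelve. all: by end_near. Qed.

Lemma cvg_sqrt_infty : (Num.sqrt x : R) @[x --> +oo] --> +oo.
Proof.
apply/cvgryPge => A; near=> x.
have A2 : `|A| ^+ 2 <= x by near: x; exact: nbhs_pinfty_ge.
apply: le_trans (ler_norm A) _.
by rewrite -[leLHS]ger0_norm// -sqrtr_sqr ler_wsqrtr.
Unshelve. all: by end_near. Qed.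

(** The substitution [t = x^2] followed by an integration by parts reduces
    this case to the Gaussian integral. *)
Lemma prim_gamma_half :
  prim (gamma_integrand 2^-1) 0 t @[t --> +oo] --> Num.sqrt (pi : R) / 2.
Proof.
have N1 : (-1 : R) < 0 by rewrite ltrN10.
have h0 : 0 <= 2^-1 :> R by rewrite invr_ge0.
have cgs : continuous (@gauss_fun R) by exact: continuous_gauss_fun.
have H : prim gauss_fun 0 (Num.sqrt t) - gamma_integrand 2^-1 t @[t --> +oo]
    --> Num.sqrt (pi : R) / 2.
  rewrite -[X in _ --> X]subr0; apply: cvgB; last exact: powR_expRN_cvg0.
  exact: cvg_comp cvg_sqrt_infty prim_gauss.
apply: cvg_trans H; apply: near_eq_cvg; near=> t.
have t0 : 0 < t by near: t; exact: nbhs_pinfty_gt.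
rewrite [RHS]/prim.
have cF x : {for x, continuous
    (fun x => prim gauss_fun (-1) (Num.sqrt x) - gamma_integrand 2^-1 x)}.
  apply: cvgB; last exact: gamma_integrand_cont.
  apply: continuous_comp; first exact: sqrt_continuous.
  by apply: prim_cont => //; rewrite (lt_le_trans N1)// sqrtr_ge0.
rewrite (@FTC_int R _ (fun x => prim gauss_fun (-1) (Num.sqrt x) - gamma_integrand 2^-1 x)).
- rewrite {2}/prim (@prim_add R gauss_fun (-1) 0 (Num.sqrt t)) ?(ltW N1) ?sqrtr_ge0//.
  rewrite sqrtr0 /gamma_integrand powRpos0 ?invr_gt0//.
  rewrite -/(prim gauss_fun 0 (Num.sqrt t)); ring.
- exact: ltW.
- exact: gamma_integrand_cont.
- exact: cF.
- exact: cF.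
- move=> x /andP[x0 xt].
  have sx : 0 < Num.sqrt x by rewrite sqrtr_gt0.
  derive_eq.
    notypeclasses refine (derB _ _).
      apply: (@der_comp _ _ _ _ (@is_derive1_sqrt R x x0) (prim gauss_fun (-1))).
      by apply: prim_is_derive => //; exact: lt_trans sx.
    rewrite /gamma_integrand /powRpos.
    apply: (@near_eq_is_derive _ _ _ (fun y => Num.sqrt y * expR (- y))).
      near=> y.
      have y0 : 0 < y by near: y; exact: lt_nbhsr.
      by rewrite max_l ?powR12_sqrt// ltW.
    by der.
  rewrite /gamma_integrand !powRposE ?ltW// powR12_sqrt ?ltW// /gauss_fun sqr_sqrtr ?ltW//.
  by field; rewrite gt_eqF.
Unshelve. all: by end_near. Qed.

Lemma Gamma_half_integers d :
  prim (gamma_integrand (d%:R / 2)) 0 t @[t --> +oo] --> Gamma (d%:R / 2 + 1 : R).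
Proof.
have step (p l : R) : 0 <= p -> prim (gamma_integrand p) 0 t @[t --> +oo] --> l ->
    prim (gamma_integrand p) 0 t @[t --> +oo] --> Gamma (p + 1).
  by move=> p0 H; rewrite (Gamma_cvg p0 H).
suff: (exists l, prim (gamma_integrand (d%:R / 2)) 0 t @[t --> +oo] --> (l : R)) /\
      (exists l, prim (gamma_integrand (d.+1%:R / 2)) 0 t @[t --> +oo] --> (l : R)).
  by case=> -[l H] _; apply: step H.
elim: d => [|d [[l1 IH1] [l2 IH2]]].
  split; first by exists 1; rewrite mul0r; exact: prim_gamma0.
  by exists (Num.sqrt pi / 2); rewrite mul1r; exact: prim_gamma_half.
split; first by exists l2.
exists ((d%:R / 2 + 1) * l1).
rewrite (_ : d.+2%:R / 2 = d%:R / 2 + 1); last by rewrite -[d.+2]addn2 natrD; field.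
by apply: prim_gammaS.
Qed.

Lemma Gamma_half_rec d :
  Gamma (d.+2%:R / 2 + 1 : R) = (d%:R / 2 + 1) * Gamma (d%:R / 2 + 1).
Proof.
apply: Gamma_cvg => //.
rewrite (_ : d.+2%:R / 2 = d%:R / 2 + 1); last by rewrite -[d.+2]addn2 natrD; field.
by apply: prim_gammaS => //; exact: Gamma_half_integers.
Qed.

Lemma Gamma_1 : Gamma (0%:R / 2 + 1 : R) = 1.
Proof. by apply: Gamma_cvg; rewrite mul0r//; exact: prim_gamma0. Qed.

Lemma Gamma_3half : Gamma (1%:R / 2 + 1 : R) = Num.sqrt pi / 2.
Proof. by apply: Gamma_cvg; rewrite mul1r//; exact: prim_gamma_half. Qed.

Lemma Gamma_half_gt0 d : 0 < Gamma (d%:R / 2 + 1 : R).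
Proof.
suff: 0 < Gamma (d%:R / 2 + 1 : R) /\ 0 < Gamma (d.+1%:R / 2 + 1 : R) by case.
elim: d => [|d [IH1 IH2]].
  by rewrite Gamma_1 Gamma_3half divr_gt0// sqrtr_gt0 pi_gt0.
split; first exact: IH2.
rewrite Gamma_half_rec; apply: mulr_gt0 IH1.
by rewrite ltr_wpDl// divr_ge0.
Qed.

Lemma ball_vol_gt0 d : 0 < ball_vol R d.
Proof. by rewrite /ball_vol divr_gt0 ?powR_gt0 ?pi_gt0 ?Gamma_half_gt0. Qed.

(** Two steps of the recurrence of Gamma give
    [V_d / V_(d+2) = (d + 2) / (2 * pi)], which [wallis_mulS] identifies with
    [1 / (W_(d+1) * W_(d+2))]; this allows an induction. *)
Lemma ball_vol_ratio d : ball_vol R d / ball_vol R d.+1 = (wallis R d.+1)^-1.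
Proof.
elim: d => [|d IH].
  rewrite wallis1 /ball_vol Gamma_1 Gamma_3half mul0r powRr0.
  rewrite (mul1r (2^-1 : R)) powR12_sqrt ?pi_ge0//.
  by field; rewrite gt_eqF// sqrtr_gt0 pi_gt0.
have b0 := ball_vol_gt0 d; have b1 := ball_vol_gt0 d.+1.
have b2 := ball_vol_gt0 d.+2.
have w1 := wallis_gt0 R d.+1; have w2 := wallis_gt0 R d.+2.
have H : ball_vol R d / ball_vol R d.+2 = d.+2%:R / (2 * pi).
  rewrite /ball_vol Gamma_half_rec.
  have -> : d.+2%:R / 2 = d%:R / 2 + 1 :> R by rewrite -[d.+2]addn2 natrD; field.
  rewrite powRD ?gt_eqF ?pi_gt0 ?implybT// powRr1 ?pi_ge0//.
  have g0 := Gamma_half_gt0 d.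
  have p0 : 0 < (pi : R) `^ (d%:R / 2) by rewrite powR_gt0 ?pi_gt0.
  have pi0 := pi_gt0 R.
  have dd : 0 < d%:R + 2 :> R by rewrite ltr_wpDl.
  rewrite -[d.+2]addn2 natrD.
  move: (pi : R) p0 pi0 (Gamma _) g0 => P p0 pi0 G g0.
  by field; rewrite !gt_eqF.
have W := wallis_mulS R d.+1.
have pi0 := pi_gt0 R.
move: (ball_vol R d) (ball_vol R d.+1) (ball_vol R d.+2) (wallis R d.+1)
  (wallis R d.+2) IH b0 b1 b2 w1 w2 H W => a b c u v IH a0 b0 c0 u0 v0 H W.
have uv : u^-1 * (b / c) = u^-1 * v^-1.
  rewrite -IH mulrA divfK ?gt_eqF// H -W.
  by rewrite IH; field; rewrite !gt_eqF.
by apply: mulfI uv; rewrite invr_eq0 gt_eqF.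
Qed.

End GammaHalf.

(** * The prefactor *)

Section Prefactor.
Variable R : realType.

Lemma prefactorE d : prefactor R d.+1 = 2 * d%:R / (d.+1%:R * wallis R d.+1).
Proof.
rewrite /prefactor (_ : d.+1%:R - 1 = d%:R :> R); last by rewrite -natr1 addrK.
have b0 := ball_vol_gt0 R d.+1; have w0 := wallis_gt0 R d.+1.
have := ball_vol_ratio R d.
move: (ball_vol R d) (ball_vol R d.+1) (wallis _ _) b0 w0 => c b w b0 w0 cb.
have -> : c = b / w by rewrite -cb mulrCA divff ?mulr1 ?gt_eqF.
by field; rewrite !gt_eqF// ltr_wpDl.
Qed.

Lemma prefactor_gt0 d : (2 <= d)%N -> 0 < prefactor R d.
Proof.
case: d => // d d1; rewrite prefactorE divr_gt0// mulr_gt0 ?ltr0n//.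
exact: wallis_gt0.
Qed.

Lemma sqrt_wallis_ge d : Num.sqrt (pi : R) <= Num.sqrt d.+1%:R * wallis R d.+1.
Proof.
have w0 := ltW (wallis_gt0 R d.+1).
rewrite -(ger0_norm w0) -sqrtr_sqr -sqrtrM//; apply: ler_wsqrtr.
have := wallis_sqr_ge R d.+1; rewrite ler_pdivrMr// => H.
have H2 : wallis R d.+1 ^+ 2 * d.+2%:R <= wallis R d.+1 ^+ 2 * (2 * d.+1%:R).
  by rewrite ler_wpM2l ?sqr_ge0// -natrM ler_nat mul2n -addnn addSnnS leq_addl.
have := le_trans H H2; move: (wallis R d.+1 ^+ 2) => W; lra.
Qed.

Lemma prefactor_le d : prefactor R d.+1 <= 2 * Num.sqrt d.+1%:R.
Proof.
have s0 : 0 < Num.sqrt d.+1%:R :> R by rewrite sqrtr_gt0.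
have w0 := wallis_gt0 R d.+1.
have H : 1 <= Num.sqrt d.+1%:R * wallis R d.+1.
  apply: le_trans (sqrt_wallis_ge d).
  by rewrite -[leLHS]sqrtr1 ler_wsqrtr// (le_trans _ (pi_ge2 R))// ler1n.
rewrite prefactorE ler_pdivrMr ?mulr_gt0//.
apply: le_trans (_ : 2 * d.+1%:R <= _); first by rewrite ler_pM2l// ler_nat.
rewrite -mulrA ler_pM2l// mulrCA -[leLHS]mulr1 ler_pM2l//.
Qed.

(** The Wallis integrals decrease, so that the product [wallis_mulS] of two
    consecutive ones bounds the square of each from both sides. *)
Lemma cvg_sqrt_wallis :
  Num.sqrt d.+1%:R * wallis R d.+1 @[d --> \oo] --> Num.sqrt (2 * pi : R).
Proof.
have E d : Num.sqrt d.+1%:R * wallis R d.+1 = Num.sqrt (d.+1%:R * wallis R d.+1 ^+ 2).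
  have w0 := ltW (wallis_gt0 R d.+1).
  by rewrite sqrtrM// sqrtr_sqr ger0_norm.
under eq_fun do rewrite E.
apply: continuous_cvg; first exact: sqrt_continuous.
apply: (@squeeze_cvgr _ _ _ _ (fun d => 2 * pi * (1 - d.+1%:R^-1)) (fun=> 2 * pi)).
- near=> d.
  have pi0 := pi_gt0 R.
  have := wallis_sqr_ge R d.+1; have := wallis_sqr_le R d.
  rewrite ler_pdivlMr// ler_pdivrMr// => H1 H2.
  rewrite [d.+1%:R * _]mulrC H1 andbT.
  have n0 : 0 < d.+1%:R :> R by [].
  have n2 : d.+2%:R = d.+1%:R + 1 :> R by rewrite natr1.
  rewrite n2 in H2.
  have H3 : 2 * (pi : R) * (1 - d.+1%:R^-1) <= 2 * pi / (d.+1%:R + 1) * d.+1%:R.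
    have P0 : 0 < 2 * pi :> R by rewrite mulr_gt0.
    move: (2 * pi : R) (d.+1%:R : R) n0 P0 => P n n0 P0.
    rewrite -subr_ge0 (_ : _ - _ = P / (n * (n + 1))).
      by rewrite divr_ge0 ?mulr_ge0 ?addr_ge0 ?ltW.
    by field; rewrite !gt_eqF ?addr_gt0.
  apply: le_trans H3 _; rewrite ler_pM2r//.
  by rewrite ler_pdivrMr ?addr_gt0.
- suff : 2 * pi * (1 - d.+1%:R^-1) @[d --> \oo] --> (2 * pi * (1 - 0) : R).
    by rewrite subr0 mulr1.
  apply: cvgM; first exact: cvg_cst.
  by apply: cvgB; [exact: cvg_cst|exact: cvg_harmonic].
- exact: cvg_cst.
Unshelve. all: by end_near. Qed.

End Prefactor.

(** * The mean value theorem and the function F *)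

Section MeanValue.
Variable R : realType.

Lemma mean_value (f df : R -> R) (a b : R) : a < b ->
  (forall x, a <= x <= b -> {for x, continuous f}) ->
  antiderivative (fun x => a < x < b) f df ->
  exists2 c, a < c < b & f b - f a = df c * (b - a).
Proof.
move=> ab cf dF.
have [||c] := @MVT R f df a b ab.
- by move=> x; rewrite in_itv/=; exact: dF.
- apply: continuous_in_subspaceT => x; rewrite inE/= in_itv/=; exact: cf.
by rewrite in_itv/= => cI fE; exists c.
Qed.

Lemma derive_gt0_lt (f df : R -> R) (a b : R) : a < b ->
  (forall x, a <= x <= b -> {for x, continuous f}) ->
  antiderivative (fun x => a < x < b) f df ->
  (forall x, a < x < b -> 0 < df x) -> f a < f b.
Proof.
move=> ab cf dF df0; have [c cI H] := mean_value ab cf dF.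
by rewrite -subr_gt0 H mulr_gt0 ?subr_gt0//; exact: df0.
Qed.

End MeanValue.

Section FProps.
Variable R : realType.

(** Normalized so that [F' z = - 2 * F_slope z / z^3]. It vanishes to third order
    at [0], which keeps the slope of [F] bounded there. *)
Definition F_slope (z : R) := ln (1 + z) - z * (2 + 3 * z) / (2 * (1 + z) ^+ 2).

Lemma is_derive_F_slope (z : R) : -1 < z ->
  is_derive z 1 F_slope (z ^+ 2 / (1 + z) ^+ 3).
Proof.
move=> z1; have z0 : 0 < 1 + z by lra.
rewrite /F_slope; derive_to => //.
  by rewrite mulf_neq0 ?expf_neq0 ?gt_eqF.
by field; rewrite gt_eqF.
Qed.

Lemma F_slope0 : F_slope 0 = 0.
Proof. by rewrite /F_slope addr0 ln1 !mul0r subrr. Qed.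

(** By [is_derive_F_slope] the derivative lies between [0] and [z^2]. *)
Lemma F_slope_bounds (z : R) : 0 < z -> 0 < F_slope z <= z ^+ 3 / 3.
Proof.
move=> z0.
have cf (x : R) : 0 <= x <= z -> {for x, continuous F_slope}.
  by move=> /andP[x0 _]; apply: is_derive_continuous (is_derive_F_slope _); lra.
apply/andP; split.
  rewrite -F_slope0; apply: (derive_gt0_lt z0 cf).
    by move=> x /andP[x0 _]; apply: is_derive_F_slope; lra.
  by move=> x /andP[x0 _]; rewrite divr_gt0 ?exprn_gt0//; lra.
pose psi (x : R) := x ^+ 3 / 3 - F_slope x.
rewrite -subr_ge0 -/(psi z) (_ : 0 = psi 0); last first.
  by rewrite /psi F_slope0 expr0n/= mul0r subrr.
have dpsi (x : R) : 0 <= x -> is_derive x 1 psi (x ^+ 2 - x ^+ 2 / (1 + x) ^+ 3).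
  move=> x0; rewrite /psi; derive_eq.
    notypeclasses refine (derB _ _); first by der.
    by apply: is_derive_F_slope; lra.
  by cbv beta; rewrite /=; field; rewrite gt_eqF//; lra.
have [||c /andP[c0 cz] H] := @mean_value R psi
  (fun x => x ^+ 2 - x ^+ 2 / (1 + x) ^+ 3) 0 z z0.
- by move=> x /andP[x0 xz]; apply: is_derive_continuous (dpsi x x0).
- by move=> x /andP[x0 xz]; apply: dpsi; exact: ltW.
rewrite -subr_ge0 H; apply: mulr_ge0; last by rewrite subr0 ltW.
rewrite subr_ge0.
rewrite ler_pdivrMr ?exprn_gt0//; last by lra.
by rewrite ler_peMr ?sqr_ge0// exprn_ege1//; lra.
Qed.

Lemma F_slope_le (z : R) : 0 < z -> F_slope z <= z.
Proof.
move=> z0; rewrite /F_slope.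
have L : ln (1 + z) <= z.
  by have := @le_ln1Dx R z; apply; lra.
have : 0 <= z * (2 + 3 * z) / (2 * (1 + z) ^+ 2).
  by rewrite divr_ge0 ?mulr_ge0 ?exprn_ge0//; lra.
lra.
Qed.

Lemma is_derive_F (z : R) : 0 < z -> is_derive z 1 (@F R) (- (2 * F_slope z / z ^+ 3)).
Proof.
move=> z0; rewrite /F; derive_to; try by rewrite gt_eqF//; lra.
  lra.
by rewrite /F_slope /=; field; rewrite !gt_eqF//; lra.
Qed.

Lemma F_mean_value (x y : R) : 0 < x -> x < y ->
  exists2 c, x < c < y & F x - F y = 2 * F_slope c / c ^+ 3 * (y - x).
Proof.
move=> x0 xy.
have [||c cI H] := @mean_value R (@F R)
  (fun z => - (2 * F_slope z / z ^+ 3)) x y xy.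
- by move=> t /andP[xt _]; apply: is_derive_continuous (is_derive_F _); lra.
- by move=> t /andP[xt _]; apply: is_derive_F; lra.
by exists c => //; rewrite -opprB H mulNr opprK.
Qed.

Lemma F_lt (x y : R) : 0 < x -> x < y -> F y < F x.
Proof.
move=> x0 xy; have [c /andP[xc cy] H] := F_mean_value x0 xy.
have c0 : 0 < c by lra.
have /andP[p0 _] := F_slope_bounds c0.
by rewrite -subr_gt0 H mulr_gt0 ?subr_gt0// divr_gt0 ?exprn_gt0// mulr_gt0.
Qed.

Lemma F_le (x y : R) : 0 < x -> x <= y -> F y <= F x.
Proof. by move=> x0; rewrite le_eqVlt => /predU1P[->//|/(F_lt x0)/ltW]. Qed.

Lemma F_lipschitz (x y : R) : 0 < x -> x <= y -> F x - F y <= 2 / 3 * (y - x).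
Proof.
move=> x0; rewrite le_eqVlt => /predU1P[->|xy]; first by rewrite !subrr mulr0.
have [c /andP[xc cy] ->] := F_mean_value x0 xy.
have c0 : 0 < c by lra.
have /andP[_ pc] := F_slope_bounds c0.
rewrite ler_pM2r ?subr_gt0// ler_pdivrMr ?exprn_gt0//; lra.
Qed.

(** Complements [F_lipschitz] for large arguments: the decay [x^-2] makes the
    inner integral converge. *)
Lemma F_lipschitz_sqr (x y : R) : 0 < x -> x <= y ->
  F x - F y <= 2 * (y - x) / x ^+ 2.
Proof.
move=> x0; rewrite le_eqVlt => /predU1P[->|xy]; first by rewrite !subrr mulr0 mul0r.
have [c /andP[xc cy] ->] := F_mean_value x0 xy.
have c0 : 0 < c by lra.
have pc := F_slope_le c0.
rewrite [leRHS]mulrAC ler_pM2r ?subr_gt0// -!mulrA ler_pM2l//.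
apply: le_trans (_ : (c ^+ 2)^-1 <= _); last first.
  by rewrite lef_pV2 ?posrE ?exprn_gt0// ler_pXn2r ?nnegrE ?(ltW x0) ?(ltW c0) ?(ltW xc).
rewrite ler_pdivrMr ?exprn_gt0// (_ : _ * _ = c)//.
by field; rewrite gt_eqF.
Qed.

End FProps.

(** * Spherical caps *)

Section Caps.
Variable R : realType.
Variable n : nat.
Hypothesis n0 : (0 < n)%N.
Local Notation mu := (@lebesgue_measure R).

Definition capw (t : R) := Num.sqrt (1 - t ^+ 2) ^+ n.

(** For [-2 <= x <= 1] this is the integral of [capw] over [[x, 1]]: up to the
    factor [V_n], the volume of the part of the unit [n.+1]-ball lying beyond the
    hyperplane at signed distance [x]. *)
Definition cap (x : R) := prim capw (-2) 1 - prim capw (-2) x.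

Lemma capw_cont : continuous capw.
Proof. by rewrite /capw; cont. Qed.

Lemma powR_half (y : R) k : 0 <= y -> y `^ (k%:R / 2) = Num.sqrt y ^+ k.
Proof. by move=> y0; rewrite mulrC powRrM powR12_sqrt// powR_mulrn// sqrtr_ge0. Qed.

Let cI := capw_cont.

Lemma cap_int (x : R) : -2 <= x -> x <= 1 -> \int[mu]_(t in `[x, 1]) capw t = cap x.
Proof.
by move=> x2 x1; rewrite /cap {1}/prim (prim_add cI x2 x1) addrAC subrr add0r.
Qed.

Lemma cap_int_left (x : R) : -1 <= x -> x <= 1 ->
  \int[mu]_(t in `[-1, x]) capw t = cap (-1) - cap x.
Proof.
move=> x1 x2; have m2 : -2 <= -1 :> R by lra.
have := prim_add cI m2 x1; rewrite -/(prim capw (-2) x) /cap => ->.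
by ring.
Qed.

Lemma cap_is_derive (x : R) : -2 < x -> is_derive x 1 cap (- capw x).
Proof.
move=> x2; rewrite /cap; derive_eq.
  notypeclasses refine (derB _ _); first exact: der_cst.
  by apply: prim_is_derive.
by rewrite sub0r.
Qed.

Lemma cap_cont (x : R) : -2 < x -> {for x, continuous cap}.
Proof. by move=> x2; apply: is_derive_continuous (cap_is_derive x2). Qed.

Lemma cap1 : cap 1 = 0.
Proof. by rewrite /cap subrr. Qed.

Lemma capw_gt0 (t : R) : -1 < t < 1 -> 0 < capw t.
Proof. by move=> ?; rewrite exprn_gt0// sqrtr_gt0; nra. Qed.

Lemma cap_lt (x y : R) : -1 <= x -> x < y -> y <= 1 -> cap y < cap x.
Proof.
move=> x1 xy y1; rewrite -ltrN2.
apply: (@derive_gt0_lt R (fun t => - cap t) capw x y xy).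
- by move=> t /andP[xt _]; apply: cvgN; apply: cap_cont; lra.
- move=> t /andP[xt _]; derive_eq.
    by notypeclasses refine (derN _); apply: cap_is_derive; lra.
  by rewrite opprK.
- by move=> t /andP[xt ty]; apply: capw_gt0; lra.
Qed.

Lemma cap_le (x y : R) : -1 <= x -> x <= y -> y <= 1 -> cap y <= cap x.
Proof.
by move=> x1; rewrite le_eqVlt => /predU1P[->//|xy y1]; exact/ltW/cap_lt.
Qed.

Lemma cap_ge0 (x : R) : -1 <= x <= 1 -> 0 <= cap x.
Proof. by move=> /andP[? ?]; rewrite -cap1 cap_le. Qed.

Lemma cap_sym (x : R) : -1 <= x <= 1 -> cap x + cap (- x) = cap (-1).
Proof.
move=> /andP[x1]; rewrite le_eqVlt => /predU1P[->|x2].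
  by rewrite cap1 add0r.
have [||c cI' H] := @mean_value R (fun t => cap t + cap (- t)) (fun=> 0) x 1 x2.
- move=> t /andP[xt t1]; apply: cvgD; first by apply: cap_cont; lra.
  apply: (@continuous_comp _ _ _ -%R cap); first exact: opp_continuous.
  by apply: cap_cont; lra.
- move=> t /andP[xt t1]; derive_eq.
    notypeclasses refine (derD _ _); first by apply: cap_is_derive; lra.
    notypeclasses refine (der_comp (derN (der_id t)) _).
    by apply: cap_is_derive; lra.
  by rewrite /capw sqrrN; ring.
by move/eqP: H; rewrite mul0r subr_eq0 cap1 add0r => /eqP ->.
Qed.

Lemma cap_wallis : cap (-1) = wallis R n.+1.
Proof.
rewrite -cap_int; [|lra..].
rewrite -wallis_cap//; apply: eq_Rintegral => t; rewrite inE/= in_itv/= => /andP[t1 t2].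
have H : 0 <= 1 - t ^+ 2 by nra.
by rewrite powRposE// -natr1 addrK powR_half.
Qed.

Let sq (x : R) := Num.sqrt (1 - x ^+ 2).

(** The difference of the two sides, with [n.+2] in place of [n.+1], vanishes
    at [1] and has derivative [- n.+2 * cap]. *)
Lemma cap_bound (x : R) : -1 < x < 1 -> n.+1%:R * x * cap x < sq x ^+ n.+2.
Proof.
move=> /andP[x1 x2].
have dsq (t : R) : -1 < t < 1 -> is_derive t 1 (fun t => sq t ^+ n.+2)
    (- (n.+2%:R * t * capw t)).
  move=> tI; rewrite /sq; have t0 : 0 < 1 - t ^+ 2 by nra.
  derive_to; first by [].
  have s0 : 0 < Num.sqrt (1 - t ^+ 2) by rewrite sqrtr_gt0.
  rewrite /= /capw; move: (Num.sqrt _) s0 (n.+2%:R : R) => S s0 N.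
  by rewrite !exprS; field; rewrite gt_eqF.
have : 0 < sq x ^+ n.+2 - n.+2%:R * x * cap x.
  have E : sq 1 ^+ n.+2 - n.+2%:R * 1 * cap 1 = 0.
    by rewrite cap1 mulr0 subr0 /sq expr1n subrr sqrtr0 expr0n.
  rewrite -oppr_lt0 -[ltRHS]oppr0 -E.
  apply: (@derive_gt0_lt R (fun t => - (sq t ^+ n.+2 - n.+2%:R * t * cap t))
     (fun t => n.+2%:R * cap t) x 1 x2).
  - move=> t /andP[xt t1]; apply: cvgN; apply: cvgB.
      by apply: (@cont_at _ (fun t => sq t ^+ n.+2)); rewrite /sq; cont.
    apply: cvgM; last by apply: cap_cont; lra.
    by apply: cvgM; [exact: cvg_cst|exact: cvg_id].
  - move=> t /andP[xt t1]; derive_eq.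
      notypeclasses refine (derN _); notypeclasses refine (derB _ _); first by apply: dsq; lra.
      notypeclasses refine (derM (derM (der_cst _ _) (der_id _)) _).
      by apply: cap_is_derive; lra.
    by cbv beta; ring.
  - move=> t /andP[xt t1]; rewrite mulr_gt0//.
    by rewrite -cap1; apply: cap_lt; lra.
rewrite subr_gt0 => H; have [x0|x0] := leP 0 x.
  apply: le_lt_trans H; rewrite -!mulrA ler_wpM2r ?ler_nat//.
  by rewrite mulr_ge0// cap_ge0 ?(ltW x1) ?(ltW x2).
apply: (@le_lt_trans _ _ 0).
  by rewrite -mulrA mulr_ge0_le0// mulr_le0_ge0 ?(ltW x0)// cap_ge0 ?(ltW x1) ?(ltW x2).
by rewrite exprn_gt0// sqrtr_gt0; nra.
Qed.

(** The ratio compares the cap with the ball over its base disc of radius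
    [sqrt (1 - x^2)]: among caps with the same base the higher one is larger.
    The sign of the derivative is [cap_bound]. *)
Lemma cap_ratio_lt (x y : R) : -1 < x -> x < y -> y < 1 ->
  cap y / sq y ^+ n.+1 < cap x / sq x ^+ n.+1.
Proof.
move=> x1 xy y1.
have dsq (t : R) : -1 < t < 1 -> is_derive t 1 (fun t => - (cap t / sq t ^+ n.+1))
    ((sq t ^+ n.+2 - n.+1%:R * t * cap t) / sq t ^+ n.+3).
  move=> tI; have t0 : 0 < 1 - t ^+ 2 by nra.
  have s0 : 0 < Num.sqrt (1 - t ^+ 2) by rewrite sqrtr_gt0.
  derive_eq.
    notypeclasses refine (derN _); notypeclasses refine (derM _ _).
      by apply: cap_is_derive; lra.
    by rewrite /sq; der => //; rewrite expf_neq0// gt_eqF.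
  rewrite /= /capw /sq; move: (Num.sqrt _) s0 => S s0.
  by rewrite !exprS; field; rewrite expf_neq0 ?gt_eqF.
rewrite -ltrN2; apply: (derive_gt0_lt xy
  (f := fun t => - (cap t / sq t ^+ n.+1))
  (df := fun t => (sq t ^+ n.+2 - n.+1%:R * t * cap t) / sq t ^+ n.+3)).
- by move=> t /andP[xt ty]; apply: is_derive_continuous (dsq t _); lra.
- by move=> t /andP[xt ty]; apply: dsq; lra.
- move=> t /andP[xt ty]; have tI : -1 < t < 1 by lra.
  rewrite divr_gt0 ?subr_gt0 ?cap_bound// exprn_gt0// sqrtr_gt0; nra.
Qed.

Lemma cap_half : cap 0 = wallis R n.+1 / 2.
Proof.
have := @cap_sym 0; rewrite oppr0 cap_wallis => /(_ _); rewrite lerN10 ler01 => /(_ isT).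
lra.
Qed.

(** A cap smaller than a half ball fits into the half ball over its base. *)
Lemma cap_le_half (x : R) : 0 <= x <= 1 ->
  cap x <= sq x ^+ n.+1 * (wallis R n.+1 / 2).
Proof.
move=> /andP[]; rewrite le_eqVlt => /predU1P[<- _|x0].
  by rewrite cap_half /sq expr0n/= subr0 sqrtr1 expr1n mul1r.
rewrite le_eqVlt => /predU1P[->|x1].
  by rewrite cap1 mulr_ge0// ?divr_ge0 ?(ltW (wallis_gt0 R n.+1))// exprn_ge0// sqrtr_ge0.
have s0 : 0 < sq x by rewrite sqrtr_gt0; nra.
rewrite mulrC -ler_pdivrMr ?exprn_gt0//.
have sq0 : sq 0 = 1 by rewrite /sq expr0n/= subr0 sqrtr1.
have := @cap_ratio_lt 0 x; rewrite cap_half sq0 expr1n divr1.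
by move=> H; apply/ltW/H => //; lra.
Qed.

End Caps.

(** * The intersection of two balls *)

Section Lune.
Variable R : realType.
Variable n : nat.
Hypothesis n0 : (0 < n)%N.
Local Notation mu := (@lebesgue_measure R).
Local Notation W := (wallis R n.+1).
Local Notation cap := (@cap R n).

Lemma sqr_le1_itv (x : R) : x ^+ 2 <= 1 -> -1 <= x <= 1.
Proof. by rewrite -ler_norml -real_normK ?num_real// expr_le1. Qed.

(** Polar coordinates [(c, s)] of the angle [theta]. The triangle has vertices
    [0], [1] and [z * (c, s)]; [D] is the length of the side opposite to [0],
    while [a] and [- b] are the cosines of its angles at [1] and at
    [z * (c, s)]. *)
Section Triangle.
Variables (c s z : R).
Hypotheses (cs1 : c ^+ 2 + s ^+ 2 = 1) (s0 : 0 <= s) (z0 : 0 <= z) (zc : 2 * c <= z).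

Let D := Num.sqrt ((1 - z * c) ^+ 2 + (z * s) ^+ 2).
Let a := (1 - z * c) / D.
Let b := (c - z) / D.

Let cI : -1 <= c <= 1.
Proof. by apply: sqr_le1_itv; rewrite -cs1 lerDl sqr_ge0. Qed.

Let c1 : c <= 1. Proof. by case/andP: cI. Qed.
Let cN1 : -1 <= c. Proof. by case/andP: cI. Qed.

Let s2E : s ^+ 2 = 1 - c ^+ 2.
Proof. by rewrite -cs1 addrC addKr. Qed.

Lemma triangle_dist : Num.sqrt ((c - z) ^+ 2 + s ^+ 2) = D.
Proof. by congr Num.sqrt; ring: s2E. Qed.

Let D2 : D ^+ 2 = 1 + z ^+ 2 - 2 * z * c.
Proof.
rewrite sqr_sqrtr ?addr_ge0 ?sqr_ge0//; ring: s2E.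
Qed.

Let Dge1 : 1 <= D ^+ 2.
Proof.
have zc0 : 0 <= z - 2 * c by rewrite subr_ge0.
by have := mulr_ge0 z0 zc0; rewrite D2; lra.
Qed.

Let D0 : 0 < D.
Proof. by rewrite lt_neqAle sqrtr_ge0 andbT; apply/eqP => E; move: Dge1; rewrite -E; lra. Qed.

Let sqa : Num.sqrt (1 - a ^+ 2) = z * s / D.
Proof.
have -> : 1 - a ^+ 2 = (z * s / D) ^+ 2.
  rewrite /a !expr_div_n; apply: (@mulIf _ (D ^+ 2)); first by rewrite expf_neq0 ?gt_eqF.
  rewrite mulrBl !divfK ?expf_neq0 ?gt_eqF// D2; ring: s2E.
by rewrite sqrtr_sqr ger0_norm// divr_ge0 ?mulr_ge0// ltW.
Qed.

Let sqb : Num.sqrt (1 - b ^+ 2) = s / D.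
Proof.
have -> : 1 - b ^+ 2 = (s / D) ^+ 2.
  rewrite /b !expr_div_n; apply: (@mulIf _ (D ^+ 2)); first by rewrite expf_neq0 ?gt_eqF.
  rewrite mulrBl !divfK ?expf_neq0 ?gt_eqF// D2; ring: s2E.
by rewrite sqrtr_sqr ger0_norm// divr_ge0 ?mulr_ge0// ltW.
Qed.

Let aI : -1 <= a <= 1.
Proof.
apply: sqr_le1_itv; rewrite /a expr_div_n ler_pdivrMr ?exprn_gt0// mul1r D2.
have := mulr_ge0 (sqr_ge0 z) (sqr_ge0 s); rewrite s2E; lra.
Qed.

Let bI : -1 <= b <= 1.
Proof.
apply: sqr_le1_itv; rewrite /b expr_div_n ler_pdivrMr ?exprn_gt0// mul1r D2.
have := sqr_ge0 s; rewrite s2E; lra.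
Qed.

Let b0 : b <= 0.
Proof. by rewrite /b ler_pdivrMr// mul0r; move: (zc) (z0); lra. Qed.

(** The volume, divided by that of the unit ball, of the intersection of the
    balls with radii [1] and [z] around the ends of the side [D]. The hyperplane
    of the intersection of the spheres cuts it into a cap of each ball. *)
Definition lens := (cap a + z ^+ n.+1 * cap (- b)) / W.

Let W0 : 0 < W := wallis_gt0 R n.+1.

(* The arithmetic tactics do not look at section hypotheses. *)
Ltac hyps := move: (z0) (zc) (s0) (c1) (cN1) (W0) => ? ? ? ? ? ?.

Lemma lens_ge0 : 0 <= lens.
Proof.
rewrite divr_ge0 ?(ltW W0)// addr_ge0 ?mulr_ge0 ?exprn_ge0 ?cap_ge0//.
by have /andP[? ?] := bI; apply/andP; split; lra.
Qed.

Let capb_le : z ^+ n.+1 * cap (- b) <= (z * s / D) ^+ n.+1 * (W / 2).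
Proof.
have zn : 0 <= z ^+ n.+1 by rewrite exprn_ge0.
rewrite -mulrA exprMn -mulrA ler_wpM2l//.
have bI' : 0 <= - b <= 1.
  by have /andP[? ?] := bI; have ? := b0; apply/andP; split; lra.
by have := cap_le_half n0 bI'; rewrite sqrrN sqb.
Qed.

Let capa_le : 0 <= a -> cap a <= (z * s / D) ^+ n.+1 * (W / 2).
Proof.
move=> a0; have aI' : 0 <= a <= 1 by rewrite a0; have /andP[] := aI.
by have := cap_le_half n0 aI'; rewrite sqa.
Qed.

Let capa_leW : cap a <= W.
Proof. by rewrite -(cap_wallis R n0); apply: cap_le; case/andP: aI. Qed.

Let a_lt0 : a < 0 -> 1 < z * c.
Proof. by rewrite /a ltr_pdivrMr// mul0r; hyps; lra. Qed.

Let k := Num.sqrt ((1 + c) / 2).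

Let k2 : k ^+ 2 = (1 + c) / 2.
Proof. by rewrite sqr_sqrtr// divr_ge0//; hyps; lra. Qed.

Let k0 : 0 <= k := sqrtr_ge0 _.

(** The left-hand side is the height of the triangle over the side [D], that is,
    the radius of the disc where the two spheres meet. After squaring, the
    difference is a multiple of [(1 - z)^2]. *)
Lemma height_le : z * s / D <= Num.sqrt z * k.
Proof.
have E : (Num.sqrt z * k) ^+ 2 = z * ((1 + c) / 2).
  by rewrite exprMn sqr_sqrtr// k2.
rewrite -(ler_pXn2r (n := 2))// ?nnegrE ?mulr_ge0 ?sqrtr_ge0 ?invr_ge0 ?(ltW D0)//.
rewrite E expr_div_n ler_pdivrMr ?exprn_gt0// D2 exprMn s2E.
have : 0 <= z * (1 + c) / 2 * (1 - z) ^+ 2.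
  by rewrite mulr_ge0 ?sqr_ge0// divr_ge0// mulr_ge0//; hyps; lra.
lra.
Qed.

(** As [b <= 0], the cap of the ball of radius [z] is at most a half ball over
    the common base. So is the other cap if [a >= 0], and the total is one ball
    of radius [height_le]. If [a < 0] that cap may be most of the unit ball, but
    then [z * c > 1], so the right-hand power is at least [1] and absorbs it. *)
Lemma lens_le : lens <= 3 / 2 * (Num.sqrt z * k) ^+ n.+1.
Proof.
rewrite /lens ler_pdivrMr//.
have H : (z * s / D) ^+ n.+1 <= (Num.sqrt z * k) ^+ n.+1.
  have h0 : 0 <= z * s / D by rewrite divr_ge0 ?mulr_ge0// ltW.
  have g0 : 0 <= Num.sqrt z * k by rewrite mulr_ge0// sqrtr_ge0.
  by rewrite lerXn2r ?nnegrE ?height_le.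
set K := (Num.sqrt z * k) ^+ n.+1 in H *.
have K2 : (z * s / D) ^+ n.+1 * (W / 2) <= K * (W / 2).
  by rewrite ler_wpM2r// divr_ge0// ltW.
have [a0|a0] := leP 0 a.
  have K0 : 0 <= K * W by rewrite mulr_ge0 ?(ltW W0)// exprn_ge0// mulr_ge0// sqrtr_ge0.
  have := capa_le a0; have := capb_le; hyps; nra.
have K1 : 1 <= K.
  apply: exprn_ege1.
  rewrite -[leLHS]sqrtr1 -(ger0_norm k0) -sqrtr_sqr -sqrtrM// ler_wsqrtr// k2.
  have := a_lt0 a0; hyps; nra.
have : 1 * W <= K * W by rewrite ler_wpM2r// ltW.
have := capa_leW; have := capb_le; hyps; nra.
Qed.

(** Keeps the argument [u - M] of [F] comparable with [u]: the base disc has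
    radius at most [sqrt (4/5) * z], because [z - c >= 1/2]. *)
Lemma lens_le_big : 1 <= z -> lens <= 9 / 10 * z ^+ n.+1.
Proof.
move=> z1; rewrite /lens ler_pdivrMr//.
have sD0 : 0 <= s / D by rewrite divr_ge0// ltW.
have sD : (s / D) ^+ 2 <= 4 / 5.
  rewrite expr_div_n ler_pdivrMr ?exprn_gt0// D2.
  have zc2 : 1 / 4 <= (z - c) ^+ 2 by case: (leP c (1/2)) => ?; hyps; nra.
  by have := sqr_ge0 c; rewrite s2E; lra.
have sD1 : s / D <= 1 by hyps; nra.
have sDn : (s / D) ^+ n.+1 <= 4 / 5.
  apply: le_trans sD; case: (n) n0 => // m _.
  by rewrite -[m.+2]add2n exprD ler_piMr ?sqr_ge0// exprn_ile1.
have u0 : 0 < z ^+ n.+1 by rewrite exprn_gt0//; hyps; lra.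
have hn : (z * s / D) ^+ n.+1 * (W / 2) <= z ^+ n.+1 * (4 / 5) * (W / 2).
  rewrite ler_wpM2r ?divr_ge0 ?(ltW W0)//.
  by rewrite -mulrA exprMn ler_wpM2l// ltW.
have uW : 0 < z ^+ n.+1 * W by rewrite mulr_gt0.
have [a0|a0] := leP 0 a.
  have := capa_le a0; have := capb_le; hyps; nra.
have u2 : 2 <= z ^+ n.+1.
  have z2 : 2 <= z ^+ 2 by have := a_lt0 a0; hyps; nra.
  apply: le_trans z2 _; case: (n) n0 => // m _.
  by rewrite -[m.+2]add2n exprD ler_peMr ?sqr_ge0// exprn_ege1.
have : 2 * W <= z ^+ n.+1 * W by rewrite ler_wpM2r// ltW.
have := capa_leW; have := capb_le; hyps; nra.
Qed.

(** Cutting the ball of radius [z] by the hyperplane of the intersection, the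
    claim is that the cap of the unit ball is smaller than the cap of the ball of
    radius [z] on the same side. They have the same base, and [b < a], so this is
    [cap_ratio_lt]. The degenerate triangles, and those with [z >= 1], are
    covered by the bounds above. *)
Lemma lens_lt : 0 < z -> lens < z ^+ n.+1.
Proof.
move=> zp; have u0 : 0 < z ^+ n.+1 by rewrite exprn_gt0.
have [z1|z1] := leP 1 z.
  by apply: le_lt_trans (lens_le_big z1) _; hyps; lra.
move: s0; rewrite le_eqVlt => /predU1P[s00|sp].
  have h0 : z * s / D = 0 by rewrite -s00 mulr0 mul0r.
  have a0 : 0 <= a by rewrite /a divr_ge0 ?(ltW D0)//; hyps; nra.
  have := capa_le a0; have := capb_le; rewrite h0 expr0n/= mul0r => H1 H2.
  rewrite /lens ltr_pdivrMr//; have : 0 < z ^+ n.+1 * W by rewrite mulr_gt0.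
  by move: H1 H2; hyps; lra.
have c1' : c < 1 by hyps; nra.
have s2 : 0 < s ^+ 2 by rewrite exprn_gt0.
have cN1' : -1 < c.
  rewrite lt_neqAle cN1 andbT; apply/eqP => E.
  by move: s2; rewrite s2E -E sqrrN expr1n subrr ltxx.
have ab : b < a.
  by rewrite /a /b ltr_pM2r ?invr_gt0//; hyps; nra.
have a1 : a < 1.
  rewrite /a ltr_pdivrMr// mul1r.
  rewrite ltNge; apply/negP => H; have : D ^+ 2 <= (1 - z * c) ^+ 2.
    by rewrite lerXn2r ?nnegrE ?(ltW D0)// (le_trans _ H)// ltW.
  have : 0 < z ^+ 2 * s ^+ 2 by rewrite mulr_gt0// exprn_gt0.
  by rewrite D2 s2E; lra.
have b1 : -1 < b.
  rewrite /b ltr_pdivlMr// mulN1r.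
  rewrite ltNge; apply/negP => H; have : D ^+ 2 <= (z - c) ^+ 2.
    by rewrite lerXn2r ?nnegrE ?(ltW D0)//; hyps; lra.
  by rewrite D2; move: s2; rewrite s2E; lra.
have := cap_ratio_lt n b1 ab a1; rewrite sqa sqb => H.
have sDp : 0 < s / D by rewrite divr_gt0.
move: H; rewrite -mulrA exprMn invfM mulrA ltr_pM2r ?invr_gt0 ?exprn_gt0//.
rewrite ltr_pdivrMr// => H.
rewrite /lens ltr_pdivrMr//.
have := @cap_sym R n b bI; rewrite (cap_wallis R n0) => E.
have -> : cap (- b) = W - cap b by hyps; lra.
by rewrite mulrBr addrA ltrBlDr addrC ltrD2l mulrC.
Qed.

Lemma lens_ge : cap a / W <= lens.
Proof.
rewrite /lens ler_pM2r ?invr_gt0// lerDl mulr_ge0 ?exprn_ge0 ?cap_ge0//.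
by have /andP[? ?] := bI; apply/andP; split; lra.
Qed.

Lemma lens_lower (q : R) : 0 <= q -> q <= s -> 1 <= z <= 2 ->
  cap (Num.sqrt (1 - (q / 3) ^+ 2)) / W <= lens.
Proof.
move=> q0 qs /andP[z1 z2]; apply: le_trans lens_ge.
rewrite ler_pM2r ?invr_gt0//.
have D3 : D <= 3.
  rewrite -(ler_pXn2r (n := 2))// ?nnegrE ?(ltW D0)// D2.
  move: cN1 z1 z2; nra.
have H : q / 3 <= z * s / D.
  have qzs : q <= z * s by apply: le_trans qs _; rewrite ler_peMl.
  rewrite ler_pdivrMr// mulrAC ler_pdivlMr//.
  by apply: ler_pM => //; exact: ltW.
apply: cap_le; first by case/andP: aI.
  apply: le_trans (ler_norm a) _; rewrite -sqrtr_sqr ler_wsqrtr//.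
  have -> : a ^+ 2 = 1 - (z * s / D) ^+ 2.
    rewrite -sqa sqr_sqrtr ?subKr// subr_ge0.
    by rewrite -real_normK ?num_real// expr_le1// ler_norml.
  rewrite lerD2l lerN2 ler_pXn2r ?nnegrE//; last by apply: le_trans H; rewrite divr_ge0.
  by rewrite divr_ge0.
by rewrite -[leRHS]sqrtr1 ler_wsqrtr// lerBlDr lerDl sqr_ge0.
Qed.

(** The bracket of [lune_ratio]: on both domains of integration the real power
    is the integer power [capw] of a square root. *)
Lemma lens_integrals :
  ball_vol R n / ball_vol R n.+1 *
    (\int[mu]_(x in `[a, 1]) ((1 - x ^+ 2) `^ ((n.+1%:R - 1) / 2))
     + z ^+ n.+1 * \int[mu]_(x in `[-1, b]) ((1 - x ^+ 2) `^ ((n.+1%:R - 1) / 2)))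
  = lens.
Proof.
have E x : -1 <= x -> x <= 1 -> (1 - x ^+ 2) `^ ((n.+1%:R - 1) / 2) = capw n x.
  move=> x1 x2; rewrite -natr1 addrK powR_half//; nra.
have /andP[a1 a2] := aI; have /andP[b1 b2] := bI.
rewrite ball_vol_ratio /lens [RHS]mulrC; congr (_ * (_ + _ * _)).
  rewrite -cap_int//; last lra.
  apply: eq_Rintegral => x; rewrite inE/= in_itv/= => /andP[? ?]; apply: E; lra.
have -> : cap (- b) = cap (-1) - cap b by have := @cap_sym R n b bI; lra.
rewrite -cap_int_left//.
apply: eq_Rintegral => x; rewrite inE/= in_itv/= => /andP[? ?]; apply: E; lra.
Qed.

End Triangle.

End Lune.

(** * The dominating function *)

Section Dominating.
Variable R : realType.
Local Notation mu := (@lebesgue_measure R).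

Let clip (u : R) := 1 + Num.max u 0.

(** This is [(1 + u)^(-3/2)] on the half-line, kept constant on its left in
    order to be continuous everywhere. *)
Definition dom (u : R) := (clip u * Num.sqrt (clip u))^-1.

Let clip_gt0 u : 0 < clip u.
Proof. by rewrite /clip ltr_pwDl// le_max lexx orbT. Qed.

Let clipE u : 0 <= u -> clip u = 1 + u.
Proof. by move=> u0; rewrite /clip max_l. Qed.

Let clip_cont : continuous clip.
Proof.
move=> u; apply: cvgD; first exact: cvg_cst.
by apply: continuous_max; [exact: cvg_id|exact: cvg_cst].
Qed.

Lemma dom_gt0 u : 0 < dom u.
Proof. by rewrite invr_gt0 mulr_gt0 ?sqrtr_gt0. Qed.

Lemma dom_cont : continuous dom.
Proof.
apply: (@contV _ (fun u => clip u * Num.sqrt (clip u))).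
  apply: contM clip_cont _.
  by apply: (@cont_comp _ _ clip_cont Num.sqrt); exact: sqrt_continuous.
by move=> u; rewrite mulf_neq0 ?gt_eqF ?sqrtr_gt0.
Qed.

Lemma dom_ge_small (u : R) : 0 <= u -> u <= 1 -> 1 <= 3 * dom u.
Proof.
move=> u0 u1; rewrite ler_pdivlMr ?mulr_gt0 ?sqrtr_gt0// mul1r clipE//.
have s1 : Num.sqrt (1 + u) <= 3 / 2.
  rewrite -(ler_pXn2r (n := 2))// ?nnegrE ?sqrtr_ge0// sqr_sqrtr; lra.
have := sqrtr_ge0 (1 + u); nra.
Qed.

Lemma dom_ge_big (u : R) : 1 <= u -> (u * Num.sqrt u)^-1 <= 3 * dom u.
Proof.
move=> u1; have u0 : 0 < u by lra.
have s0 : 0 < Num.sqrt u by rewrite sqrtr_gt0.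
rewrite ler_pdivlMr ?mulr_gt0 ?sqrtr_gt0// clipE ?(ltW u0)//.
rewrite mulrC ler_pdivrMr ?mulr_gt0//.
have s1 : Num.sqrt (1 + u) <= 3 / 2 * Num.sqrt u.
  rewrite -(ler_pXn2r (n := 2))// ?nnegrE ?mulr_ge0 ?sqrtr_ge0// exprMn !sqr_sqrtr; lra.
apply: le_trans (_ : (1 + u) * (3 / 2 * Num.sqrt u) <= _).
  by rewrite ler_wpM2l//; lra.
by nra.
Qed.

Lemma integral_dom : (\int[mu]_(u in `[0%R, +oo[) (dom u)%:E = 2%:E)%E.
Proof.
have c0 : clip 0 = 1 by rewrite clipE ?addr0.
rewrite (@FTC_inty R dom (fun u => - (2 * (Num.sqrt (clip u))^-1)) 0 0).
- by rewrite c0 sqrtr1 invr1 mulr1 opprK add0r.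
- by move=> x _; exact/ltW/dom_gt0.
- exact: dom_cont.
- apply: cont_at; apply: contN; apply: contM; first exact: cont_cst.
  apply: (@contV _ (fun u => Num.sqrt (clip u))).
    by apply: (@cont_comp _ _ clip_cont Num.sqrt); exact: sqrt_continuous.
  by move=> u /=; rewrite gt_eqF// sqrtr_gt0 clip_gt0.
- rewrite -oppr0 -(mulr0 2); apply: cvgN; apply: cvgM; first exact: cvg_cst.
  apply: (@cvg_comp _ _ _ (fun u => Num.sqrt (clip u)) (fun x => x^-1) _ (+oo)).
    apply: (@cvg_comp _ _ _ clip Num.sqrt _ (+oo)); last exact: cvg_sqrt_infty.
    apply/cvgryPge => A; near=> u.
    have Au : A <= u.
      by near: u; apply: nbhs_pinfty_ge; exact: num_real.
    apply: (le_trans Au).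
    by rewrite /clip ler_wpDl// le_max lexx.
  exact: cvgV_infty.
- move=> x x0; have x1 : 0 < 1 + x by lra.
  apply: (@near_eq_is_derive R R R (fun u : R => - (2 * (Num.sqrt (1 + u))^-1))
    (fun u : R => - (2 * (Num.sqrt (clip u))^-1)) x 1 (dom x)).
    near=> y; rewrite clipE//; apply: ltW; near: y; exact: lt_nbhsr.
  derive_to => //; first by rewrite gt_eqF// sqrtr_gt0.
  rewrite /dom clipE ?(ltW x0)//.
  have s0 : 0 < Num.sqrt (1 + x) by rewrite sqrtr_gt0.
  have E : 1 + x = Num.sqrt (1 + x) ^+ 2 by rewrite sqr_sqrtr// ltW.
  rewrite [in RHS]E; move: (Num.sqrt (1 + x)) s0 => S s0.
  rewrite sqrtr_sqr ger0_norm ?(ltW s0)//.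
  by field; rewrite gt_eqF.
Unshelve. all: by end_near. Qed.

End Dominating.

(** * Positivity and finiteness of the second quantity *)

Section Tminus.
Variable R : realType.
Variable n : nat.
Hypothesis n0 : (0 < n)%N.
Local Notation mu := (@lebesgue_measure R).
Local Notation d := n.+1.

(** The value is opaque, because the unary numeral should not be computed
    with. *)
Fact gap_const_subproof : {K : R | K = 900}. Proof. by exists 900. Qed.
Definition gap_const : R := sval gap_const_subproof.
Lemma gap_constE : gap_const = 900. Proof. exact: svalP gap_const_subproof. Qed.
Lemma gap_const_ge0 : 0 <= gap_const. Proof. by rewrite gap_constE; exact: ler0n. Qed.

Definition gap (theta u : R) :=
  F (lune_ratio d (u `^ (d%:R^-1)) theta) - F u.

Lemma powR_root (u : R) : 0 <= u -> (u `^ (d%:R^-1)) ^+ d = u.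
Proof.
by move=> u0; rewrite -powR_mulrn ?powR_ge0// -powRrM mulVf ?powRr1// pnatr_eq0.
Qed.

Section Pointwise.
Variables theta u : R.
Hypotheses (thI : 0 <= theta <= pi) (u_ge : zmin theta ^+ d <= u).

Let z := u `^ (d%:R^-1).
Let c := cos theta.
Let s := sin theta.

Let zm0 : 0 <= zmin theta. Proof. by rewrite /zmin le_max lexx orbT. Qed.
Let u0 : 0 <= u. Proof. by apply: le_trans u_ge; rewrite exprn_ge0. Qed.
Let z0 : 0 <= z. Proof. exact: powR_ge0. Qed.
Let zd : z ^+ d = u. Proof. exact: powR_root. Qed.
Let zc : 2 * c <= z.
Proof.
apply: (@le_trans _ _ (zmin theta)); first by rewrite /zmin le_max lexx.
by rewrite -(ler_pXn2r (n := d))// ?nnegrE// zd.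
Qed.
Let s0 : 0 <= s. Proof. exact: sin_ge0_pi. Qed.
Let cs1 : c ^+ 2 + s ^+ 2 = 1. Proof. exact: cos2Dsin2. Qed.

Local Notation M := (lens n c s z).

Lemma lune_ratioE : lune_ratio d z theta = u - M.
Proof.
rewrite /lune_ratio /= (triangle_dist z cs1) -[in RHS]zd; congr (_ - _).
exact: (lens_integrals n cs1 z0 zc).
Qed.

Let k := Num.sqrt ((1 + c) / 2).

Let sqrt_zd : Num.sqrt z ^+ d = Num.sqrt u.
Proof.
by rewrite -zd -[in RHS](sqr_sqrtr z0) exprAC sqrtr_sqr ger0_norm ?exprn_ge0// sqrtr_ge0.
Qed.

Let M_le : M <= 3 / 2 * (Num.sqrt u * k ^+ d).
Proof. by rewrite -sqrt_zd -exprMn; exact: (lens_le n0 cs1 s0 z0 zc). Qed.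

Let M_ge0 : 0 <= M := lens_ge0 n cs1 z0 zc.

Let gapE : gap theta u = F (u - M) - F u.
Proof. by rewrite /gap -lune_ratioE. Qed.

Let M_lt : 0 < u -> M < u.
Proof.
move=> up; rewrite -zd; apply: (lens_lt n0 cs1 s0 z0 zc).
by rewrite /z powR_gt0.
Qed.

Lemma gap0 : u = 0 -> gap theta u = 0.
Proof.
move=> uE; have : M = 0; last by rewrite gapE => ->; rewrite subr0 subrr.
by apply/eqP; rewrite eq_le M_ge0 andbT; apply: le_trans M_le _; rewrite uE sqrtr0 mul0r mulr0.
Qed.

Lemma gap_ge0 : 0 <= gap theta u.
Proof.
move: u0; rewrite le_eqVlt => /predU1P[/esym/gap0->//|up].
rewrite gapE subr_ge0; apply: F_le; first by rewrite subr_gt0 M_lt.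
by rewrite gerBl.
Qed.

(** For [u <= 1] this is [F_lipschitz] with [M <= 3/2 * sqrt u * k^d]. For
    [u > 1], where [M <= 9/10 * u], the slope bound [2 / (u - M)^2 <= 200 / u^2] leaves
    [300 * k^d * u^(-3/2)], and [dom_ge_big] costs a factor [3]: whence [900]. *)
Lemma gap_le : gap theta u <= gap_const * k ^+ d * dom u.
Proof.
have kd0 : 0 <= k ^+ d by rewrite exprn_ge0// sqrtr_ge0.
move: (u0); rewrite le_eqVlt => /predU1P[/esym uE|up].
  rewrite (gap0 uE); exact: mulr_ge0 (mulr_ge0 gap_const_ge0 kd0) (ltW (dom_gt0 u)).
rewrite gap_constE.
have l0 : 0 < u - M by rewrite subr_gt0 M_lt.
have l1 : u - M <= u by rewrite gerBl.
have uM : u - (u - M) = M by rewrite subKr.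
rewrite gapE; have [u1|u1] := leP u 1.
  apply: le_trans (F_lipschitz l0 l1) _; rewrite uM.
  have H1 : 2 / 3 * M <= Num.sqrt u * k ^+ d by move: M_le; lra.
  apply: le_trans H1 _.
  have su1 : Num.sqrt u <= 1 by rewrite -[leRHS]sqrtr1 ler_wsqrtr.
  have H2 : Num.sqrt u * k ^+ d <= k ^+ d by rewrite ler_piMl.
  apply: le_trans H2 _.
  have := ler_wpM2l kd0 (dom_ge_small u0 u1); have := mulr_ge0 kd0 (ltW (dom_gt0 u)).
  lra.
apply: le_trans (F_lipschitz_sqr l0 l1) _; rewrite uM.
have z1 : 1 <= z by rewrite -(@powRr0 _ u) /z ler_powR ?(ltW u1)// invr_ge0.
have := lens_le_big n0 cs1 s0 z0 zc z1; rewrite zd => Mb.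
have su0 : 0 < Num.sqrt u by rewrite sqrtr_gt0.
apply: (@le_trans _ _ (2 * M / (u / 10) ^+ 2)).
  apply: ler_wpM2l; first exact: mulr_ge0 (ler0n R 2) M_ge0.
  have u10 : 0 < u / 10 by lra.
  rewrite lef_pV2 ?posrE ?exprn_gt0// ler_pXn2r// ?nnegrE ?(ltW l0) ?(ltW u10)//.
  by move: Mb; lra.
apply: (@le_trans _ _ (300 * k ^+ d * (u * Num.sqrt u)^-1)).
  have E : u = Num.sqrt u ^+ 2 by rewrite sqr_sqrtr.
  have -> : 300 * k ^+ d * (u * Num.sqrt u)^-1 =
     2 * (3 / 2 * (Num.sqrt u * k ^+ d)) / (u / 10) ^+ 2.
    move: E; move: (Num.sqrt u) su0 => S S0 ->.
    by field; rewrite gt_eqF.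
  rewrite ler_pM2r ?invr_gt0 ?exprn_gt0; [|lra..].
  by rewrite ler_pM2l.
have := ler_wpM2l kd0 (dom_ge_big (ltW u1)); lra.
Qed.

(** On [1 <= u <= 1 + e / 2] the lens has volume at least [e], so that [F] is
    evaluated at a point at most [1 - e / 2] and at one at least [1]. *)
Lemma gap_lower (q e : R) : 0 <= q -> q <= s ->
  e = cap n (Num.sqrt (1 - (q / 3) ^+ 2)) / wallis R d -> 0 <= e <= 1 ->
  1 <= u <= 1 + e / 2 -> F (1 - e / 2) - F 1 <= gap theta u.
Proof.
move=> q0 qs eE /andP[e0 e1] /andP[u1 u2].
have up : 0 < u by lra.
have z1 : 1 <= z by rewrite -(@powRr0 _ u) /z ler_powR// invr_ge0.
have z2 : z <= 2.
  apply: (@le_trans _ _ u); last by lra.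
  by rewrite -[leRHS]zd -[leLHS]expr1 ler_weXn2l.
have zI : 1 <= z <= 2 by rewrite z1 z2.
have := lens_lower n cs1 s0 z0 zc q0 qs zI; rewrite -eE => eM.
have := M_lt up => Mu.
rewrite gapE lerB//; last by apply: F_le.
apply: F_le; lra.
Qed.

End Pointwise.

Lemma Tminus_integralE : Tminus_integral R d =
  (\int[mu]_(theta in `[0%R, pi]) ((sin theta ^+ (d - 2))%:E *
    \int[mu]_(u in `[(zmin theta ^+ d)%R, +oo[) (gap theta u)%:E))%E.
Proof. by []. Qed.

Let zmin_ge0 (th : R) : 0 <= zmin th ^+ d.
Proof. by rewrite exprn_ge0// /zmin le_max lexx orbT. Qed.

Let inner_ge0 th : 0 <= th <= pi ->
  (0 <= \int[mu]_(u in `[(zmin th ^+ d)%R, +oo[) (gap th u)%:E)%E.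
Proof.
move=> thI; apply: integral_ge0 => u /=; rewrite in_itv/= andbT => uz.
by rewrite lee_fin gap_ge0.
Qed.

Let outer_ge0 th : 0 <= th <= pi ->
  (0 <= (sin th ^+ (d - 2))%:E *
    \int[mu]_(u in `[(zmin th ^+ d)%R, +oo[) (gap th u)%:E)%E.
Proof.
move=> thI; apply: mule_ge0; last exact: inner_ge0.
by rewrite lee_fin exprn_ge0// sin_ge0_pi.
Qed.

Lemma half_cos (th : R) : 0 <= th <= pi -> Num.sqrt ((1 + cos th) / 2) = cos (th / 2).
Proof.
move=> /andP[t0 t1].
have c0 : 0 <= cos (th / 2).
  by apply: cos_ge0_pihalf; have := pi_gt0 R; lra.
rewrite -[RHS]ger0_norm// -sqrtr_sqr; congr Num.sqrt.
have -> : cos th = cos ((th / 2) *+ 2) by congr cos; rewrite -mulr_natr divfK.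
by rewrite cos_mulr2n -mulr_natr; field.
Qed.

Lemma inner_le th : 0 <= th <= pi ->
  (\int[mu]_(u in `[(zmin th ^+ d)%R, +oo[) (gap th u)%:E <=
   (2 * gap_const * cos (th / 2) ^+ d)%:E)%E.
Proof.
move=> thI.
have k0 : 0 <= gap_const * cos (th / 2) ^+ d.
  by rewrite (mulr_ge0 gap_const_ge0)// exprn_ge0// -half_cos// sqrtr_ge0.
have -> : (2 * gap_const * cos (th / 2) ^+ d)%:E =
    (\int[mu]_(u in `[0%R, +oo[) ((gap_const * cos (th / 2) ^+ d)%:E * (dom u)%:E))%E.
  rewrite ge0_integralZl_EFin//.
  - by rewrite integral_dom -EFinM; congr EFin; ring.
  - by move=> u _; rewrite lee_fin ltW// dom_gt0.
  - by apply: continuous_emeasurable => //; exact: dom_cont.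
apply: le_integral_extension => u /=; rewrite !in_itv/= !andbT => uz.
- exact: le_trans uz.
- by rewrite lee_fin gap_ge0.
- by rewrite -EFinM lee_fin mulr_ge0// ltW// dom_gt0.
- by rewrite -EFinM lee_fin -half_cos//; exact: gap_le.
Qed.

Lemma Tminus_integral_ge0 : (0 <= Tminus_integral R d)%E.
Proof.
rewrite Tminus_integralE; apply: integral_ge0 => th /=; rewrite in_itv/=; exact: outer_ge0.
Qed.

(** After [dom] has been integrated over [u], only the angular integral is
    left. *)
Lemma Tminus_integral_le (g : R -> R) :
  (forall th, 0 <= th <= pi ->
     2 * gap_const * (sin th ^+ (d - 2) * cos (th / 2) ^+ d) <= g th) ->
  (Tminus_integral R d <= \int[mu]_(th in `[0%R, pi]) (g th)%:E)%E.
Proof.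
move=> H; rewrite Tminus_integralE.
apply: le_integral_extension => th //=; rewrite in_itv/= => thI.
- exact: outer_ge0.
- rewrite lee_fin; apply: le_trans (H th thI).
  by rewrite !mulr_ge0 ?gap_const_ge0 ?exprn_ge0 ?sin_ge0_pi// -half_cos// sqrtr_ge0.
- apply: le_trans (_ : (sin th ^+ (d - 2))%:E * (2 * gap_const * cos (th / 2) ^+ d)%:E <= _)%E.
    by apply: lee_wpmul2l; [rewrite lee_fin exprn_ge0// sin_ge0_pi|exact: inner_le].
  by rewrite -EFinM lee_fin mulrCA; exact: H.
Qed.

(** On [pi/2 <= theta <= pi/2 + 1] the lower limit of the inner integral is [0]
    and the sine stays above [cos 1]; there [gap_lower] bounds the integrand
    below by a constant for [u] in an interval of positive length. *)
Lemma Tminus_integral_gt0 : (0 < Tminus_integral R d)%E.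
Proof.
have q0 : 0 < cos 1 :> R := cos1_gt0 R.
have q1 := cos_le1 (1 : R).
set q : R := cos 1 in q0 q1.
have W0 := wallis_gt0 R d.
pose a := Num.sqrt (1 - (q / 3) ^+ 2).
have a0 : 0 <= a by exact: sqrtr_ge0.
have a1 : a < 1.
  rewrite -[ltRHS]sqrtr1 ltr_sqrt// ltrBlDr ltrDl exprn_gt0//; lra.
pose e := cap n a / wallis R d.
have e0 : 0 < e.
  rewrite divr_gt0// -(cap1 R n); apply: cap_lt => //; lra.
have e1 : e <= 1.
  rewrite ler_pdivrMr// mul1r -(cap_wallis R n0); apply: cap_le; lra.
pose eta := F (1 - e / 2) - F (1 : R).
have eta0 : 0 < eta by rewrite subr_gt0; apply: F_lt; lra.
have pi2 := pihalf_ge1 R.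
have thP th : pi / 2 <= th <= pi / 2 + 1 ->
    [/\ 0 <= th <= pi, q <= sin th & zmin th = 0].
  move=> /andP[t1 t2].
  have thI : 0 <= th <= pi by apply/andP; split; lra.
  split => //.
    have -> : sin th = cos (th - pi / 2) by rewrite cosBpihalf.
    rewrite /q leNgt ltr_cos -?leNgt ?in_itv/=; lra.
  rewrite /zmin max_r// mulr_ge0_le0//.
  have -> : th = (th - pi / 2) + pi / 2 by lra.
  rewrite cosDpihalf oppr_le0 sin_ge0_pi//; lra.
have inner th : pi / 2 <= th <= pi / 2 + 1 ->
    ((eta * (e / 2))%:E <= \int[mu]_(u in `[(zmin th ^+ d)%R, +oo[) (gap th u)%:E)%E.
  move=> /thP[thI qs z0].
  have -> : (eta * (e / 2))%:E = (\int[mu]_(u in `[1%R, (1 + e / 2)%R]) eta%:E)%E.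
    rewrite integral_cst_itv; last by rewrite lerDl divr_ge0// ltW.
    by congr (_ * _)%:E; ring.
  rewrite z0 expr0n/=.
  apply: le_integral_extension => u /=; rewrite !in_itv/= ?andbT.
  - by move=> /andP[u1 _]; lra.
  - by move=> _; rewrite lee_fin ltW.
  - by move=> u0; rewrite lee_fin gap_ge0// z0 expr0n.
  - move=> uI; rewrite lee_fin; apply: (@gap_lower th u thI _ q e) => //.
    + by rewrite z0 expr0n/=; case/andP: uI => u1 _; lra.
    + exact: ltW.
    + by rewrite (ltW e0).
have K0 : 0 < q ^+ (d - 2) * (eta * (e / 2)) by rewrite mulr_gt0 ?exprn_gt0// mulr_gt0// divr_gt0.
apply: (@lt_le_trans _ _ (q ^+ (d - 2) * (eta * (e / 2)))%:E).
  by rewrite lte_fin.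
have -> : (q ^+ (d - 2) * (eta * (e / 2)))%:E =
   (\int[mu]_(th in `[(pi / 2)%R, (pi / 2 + 1)%R]) (q ^+ (d - 2) * (eta * (e / 2)))%:E)%E.
  rewrite integral_cst_itv; last by rewrite lerDl.
  by congr EFin; ring.
rewrite Tminus_integralE.
apply: le_integral_extension => th /=; rewrite !in_itv/=.
- by move=> /thP[].
- by move=> _; rewrite lee_fin ltW.
- exact: outer_ge0.
- move=> thI; rewrite EFinM; have [thI' qs z0] := thP _ thI.
  apply: lee_pmul; rewrite ?lee_fin ?exprn_ge0 ?(ltW q0)//.
    by rewrite mulr_ge0 ?(ltW eta0)// divr_ge0 ?(ltW e0).
    by rewrite lerXn2r ?nnegrE ?(ltW q0)// sin_ge0_pi.
  exact: inner.
Qed.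

Lemma Tminus_integral_fin : (Tminus_integral R d < +oo)%E.
Proof.
apply: le_lt_trans (@Tminus_integral_le (fun=> 2 * gap_const) _) _.
  move=> th thI; rewrite -[leRHS]mulr1 ler_wpM2l ?mulr_ge0 ?gap_const_ge0//.
  have k0 : 0 <= cos (th / 2) by rewrite -half_cos// sqrtr_ge0.
  by rewrite mulr_ile1 ?exprn_ge0 ?sin_ge0_pi ?exprn_ile1 ?sin_le1 ?cos_le1 ?sin_ge0_pi.
by rewrite integral_cst_itv ?pi_ge0// ltry.
Qed.

Lemma Tminus_gt0 : 0 < Tminus R d.
Proof.
rewrite /Tminus mulr_gt0 ?prefactor_gt0// fine_gt0//.
by rewrite Tminus_integral_gt0 Tminus_integral_fin.
Qed.

End Tminus.

(** * The rate of the second quantity *)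

Section TminusO.
Variable R : realType.
Local Notation mu := (@lebesgue_measure R).
Local Notation r3 := (Num.sqrt 3 : R).
Local Notation rate := (4 * r3 / 9).

Lemma sqrt3_sqr : r3 ^+ 2 = 3.
Proof. by rewrite sqr_sqrtr. Qed.

Lemma sqrt3_gt0 : 0 < r3. Proof. by rewrite sqrtr_gt0. Qed.

Lemma rate_gt0 : 0 < rate.
Proof. by rewrite divr_gt0// mulr_gt0// sqrt3_gt0. Qed.

Lemma bernoulli_ge (y : R) m : 0 <= y -> 1 + m%:R * y <= (1 + y) ^+ m.
Proof.
move=> y0; elim: m => [|m IH]; first by rewrite mul0r addr0 expr0.
rewrite exprS -natr1.
have : (1 + y) * (1 + m%:R * y) <= (1 + y) * (1 + y) ^+ m by rewrite ler_wpM2l//; lra.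
have : 0 <= m%:R * y ^+ 2 by rewrite mulr_ge0// sqr_ge0.
by move: ((1 + y) ^+ m) => Y; lra.
Qed.

(** The tangent parabola at the maximum lies above the cubic on the half-line,
    their difference being [2 * x * (x - r3 / 3)^2]; then
    [1 - t <= 1 / (1 + t)]. *)
Lemma cubic_le (x : R) : 0 <= x ->
  2 * (x * (1 - x ^+ 2)) <= rate / (1 + 3 * (x - r3 / 3) ^+ 2).
Proof.
move=> x0; have t0 : 0 <= 3 * (x - r3 / 3) ^+ 2 by rewrite mulr_ge0// sqr_ge0.
apply: (@le_trans _ _ (rate * (1 - 3 * (x - r3 / 3) ^+ 2))).
  rewrite -subr_ge0.
  have -> : rate * (1 - 3 * (x - r3 / 3) ^+ 2) - 2 * (x * (1 - x ^+ 2)) =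
      2 * x * (x - r3 / 3) ^+ 2.
    by have := sqrt3_sqr; move: r3 => r E; field: E.
  by rewrite mulr_ge0 ?sqr_ge0// mulr_ge0.
rewrite ler_pM2l ?rate_gt0//.
move: (3 * _) t0 => t t0.
rewrite -[leRHS]mul1r ler_pdivlMr; last lra.
have := sqr_ge0 t; lra.
Qed.

(** One factor [cos (th / 2)] is kept on the right: it is the derivative that
    integrates the Cauchy density in [sin (th / 2)] explicitly. *)
Lemma trig_bound (th : R) m : 0 <= th <= pi ->
  sin th ^+ m * cos (th / 2) ^+ m.+2 <=
  rate ^+ m * (cos (th / 2) / (1 + m%:R * (3 * (sin (th / 2) - r3 / 3) ^+ 2))).
Proof.
move=> /andP[t0 t1].
have -> : sin th = 2 * (sin (th / 2) * cos (th / 2)).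
  have -> : sin th = sin ((th / 2) *+ 2) by congr sin; rewrite -mulr_natr divfK.
  by rewrite sin_mulr2n -mulr_natl (mulrC (cos _)).
have x0 : 0 <= sin (th / 2) by apply: sin_ge0_pi; have := pi_gt0 R; lra.
have y0 : 0 <= cos (th / 2) by apply: cos_ge0_pihalf; have := pi_gt0 R; lra.
have y1 : cos (th / 2) <= 1 := cos_le1 _.
have xy := cos2sin2 (th / 2).
move: (sin _) (cos _) x0 y0 y1 xy => x y x0 y0 y1 xy.
have -> : (2 * (x * y)) ^+ m * y ^+ m.+2 = (2 * (x * (1 - x ^+ 2))) ^+ m * y ^+ 2.
  by rewrite -xy -[m.+2]addn2 exprD mulrA -exprMn; congr (_ ^+ _ * _); ring.
have C := cubic_le x0.
have t0' : 0 <= 3 * (x - r3 / 3) ^+ 2 by rewrite mulr_ge0// sqr_ge0.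
move: (3 * _) C t0' => t C t0'.
have B := bernoulli_ge m t0'.
have b0 : 0 < 1 + m%:R * t by rewrite ltr_pwDl// mulr_ge0.
rewrite [leRHS]mulrA [leRHS]mulrAC.
apply: ler_pM; rewrite ?exprn_ge0 ?mulr_ge0//.
- by rewrite -xy sqr_ge0.
- apply: (@le_trans _ _ ((rate / (1 + t)) ^+ m)).
    have c0 : 0 <= 2 * (x * (1 - x ^+ 2)).
      by rewrite mulr_ge0// mulr_ge0// -xy sqr_ge0.
    have q0 := le_trans c0 C.
    by rewrite lerXn2r ?nnegrE.
  rewrite expr_div_n ler_wpM2l ?exprn_ge0 ?(ltW rate_gt0)//.
  by rewrite lef_pV2 ?posrE ?exprn_gt0//; lra.
- by rewrite expr2 ler_piMl.
Qed.

Lemma trig_integral m : (0 < m)%N ->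
  (\int[mu]_(th in `[0%R, pi])
    (cos (th / 2) / (1 + m%:R * (3 * (sin (th / 2) - r3 / 3) ^+ 2)))%:E <=
   (2 * pi / Num.sqrt (3 * m%:R))%:E)%E.
Proof.
move=> m0; have m0' : 0 < 3 * m%:R :> R by rewrite mulr_gt0// ltr0n.
set S := Num.sqrt (3 * m%:R).
have S0 : 0 < S by rewrite sqrtr_gt0.
have S2 : S ^+ 2 = 3 * m%:R by rewrite sqr_sqrtr// ltW.
have D0 (th : R) : 0 < 1 + m%:R * (3 * (sin (th / 2) - r3 / 3) ^+ 2).
  by rewrite ltr_pwDl// mulr_ge0// mulr_ge0// sqr_ge0.
pose G (th : R) := 2 / S * atan (S * (sin (th / 2) - r3 / 3)).
have cG : continuous G by rewrite /G; cont.
rewrite (@FTC_eint R _ G).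
- rewrite lee_fin /G -mulrBr (mulrAC 2 pi).
  have A1 := atan_ltpi2 (S * (sin (pi / 2) - r3 / 3)).
  have A2 := atan_gtNpi2 (S * (sin (0 / 2) - r3 / 3)).
  rewrite ler_pM2l ?divr_gt0//; lra.
- exact: pi_ge0.
- apply: contM; first by cont.
  by apply: (@contV _ (fun th : R => 1 + m%:R * (3 * (sin (th / 2) - r3 / 3) ^+ 2)));
    [cont|move=> th; rewrite gt_eqF].
- exact: cG.
- exact: cG.
- move=> th _; rewrite /G; derive_to; rewrite exprMn S2.
  have := D0 th; rewrite !mulrA (mulrC m%:R); move: (1 + _) => D Dp.
  by field; rewrite !gt_eqF.
Qed.

(** The factor [sqrt d] of [prefactor_le] cancels the [1 / sqrt d] of
    [trig_integral]. *)
Lemma Tminus_le m : (0 < m)%N ->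
  Tminus R m.+2 <= 8 * pi * gap_const R * rate ^+ m.
Proof.
move=> m0; have K0 := gap_const_ge0 R.
have r0 : 0 <= rate ^+ m by rewrite exprn_ge0 ?ltW ?rate_gt0.
pose f (th : R) := cos (th / 2) / (1 + m%:R * (3 * (sin (th / 2) - r3 / 3) ^+ 2)).
have fin := @Tminus_integral_fin R m.+1 isT.
have ge0 := @Tminus_integral_ge0 R m.+1 isT.
have H : (Tminus_integral R m.+2 <=
    (2 * gap_const R * rate ^+ m * (2 * pi / Num.sqrt (3 * m%:R)))%:E)%E.
  apply: le_trans (@Tminus_integral_le R m.+1 isT
    (fun th => 2 * gap_const R * rate ^+ m * f th) _) _.
    move=> th thI; rewrite -[leRHS]mulrA ler_wpM2l ?mulr_ge0//.
    by rewrite subn2; exact: trig_bound.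
  under eq_integral do rewrite EFinM.
  rewrite ge0_integralZl_EFin//.
  - rewrite [leRHS]EFinM; apply: lee_wpmul2l; last exact: trig_integral.
    by rewrite lee_fin !mulr_ge0.
  - move=> th; rewrite /= in_itv/= => /andP[t0 t1].
    rewrite lee_fin /f divr_ge0//.
      by apply: cos_ge0_pihalf; have := pi_gt0 R; lra.
    by rewrite addr_ge0// mulr_ge0// mulr_ge0// sqr_ge0.
  - apply: continuous_emeasurable => //; rewrite /f.
    apply: contM; first by cont.
    apply: (@contV _ (fun th : R => 1 + m%:R * (3 * (sin (th / 2) - r3 / 3) ^+ 2))).
      by cont.
    by move=> th; rewrite gt_eqF// ltr_pwDl// mulr_ge0// mulr_ge0// sqr_ge0.
  - by rewrite !mulr_ge0.
have Hf : fine (Tminus_integral R m.+2) <=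
    2 * gap_const R * rate ^+ m * (2 * pi / Num.sqrt (3 * m%:R)).
  by rewrite -lee_fin fineK// ge0_fin_numE.
have m0' : 0 < 3 * m%:R :> R by rewrite mulr_gt0// ltr0n.
have sq : Num.sqrt m.+2%:R <= Num.sqrt (3 * m%:R) :> R.
  rewrite ler_wsqrtr// -natrM ler_nat; case: m m0 {r0 f fin ge0 H Hf m0'} => // m _.
  by rewrite mulnS -[m.+3]add3n leq_add2l leq_pmull.
rewrite /Tminus.
apply: (@le_trans _ _ (2 * Num.sqrt m.+2%:R *
   (2 * gap_const R * rate ^+ m * (2 * pi / Num.sqrt (3 * m%:R))))).
  apply: ler_pM => //; first exact/ltW/prefactor_gt0.
    exact: fine_ge0.
  exact: prefactor_le.
have s3 : 0 < Num.sqrt (3 * m%:R) :> R by rewrite sqrtr_gt0.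
move: (Num.sqrt m.+2%:R) (Num.sqrt (3 * m%:R)) sq s3 => a b ab b0.
have -> : 2 * a * (2 * gap_const R * rate ^+ m * (2 * pi / b)) =
   (8 * pi * gap_const R * rate ^+ m) * (a / b).
  by move: (pi : R) (rate ^+ m) => P Q; field; rewrite gt_eqF.
by rewrite ler_piMr ?ler_pdivrMr ?mul1r// !mulr_ge0// pi_ge0.
Qed.

Lemma Tminus_bigO :
  Tminus R =O_\oo (fun d : nat => (4 * Num.sqrt 3 / 9) ^+ d).
Proof.
apply/eqO_exP; exists (8 * pi * gap_const R / rate ^+ 2 + 1).
  rewrite ltr_pwDr// divr_ge0 ?exprn_ge0 ?(ltW rate_gt0)// mulr_ge0 ?gap_const_ge0//.
  by rewrite mulr_ge0// pi_ge0.
near=> d.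
have d3 : (3 <= d)%N by near: d; exact: nbhs_infty_ge.
have -> : d = (d - 2).+2 by rewrite -addn2 subnK// ltnW.
have m0 : (0 < d - 2)%N by rewrite subn_gt0.
move: (d - 2)%N m0 => m m0.
have T0 := ltW (@Tminus_gt0 R m.+1 isT).
have r0 := rate_gt0.
have rd : 0 <= rate ^+ m.+2 by rewrite exprn_ge0// ltW.
rewrite (ger0_norm T0) (ger0_norm rd).
apply: le_trans (Tminus_le m0) _.
move: (8 * pi * gap_const R) rate r0 rd => A r r0 rd.
rewrite mulrDl mul1r -[X in X <= _]addr0 lerD// le_eqVlt; apply/orP; left.
by apply/eqP; rewrite -[m.+2]addn2 exprD; field; rewrite gt_eqF.
Unshelve. all: by end_near. Qed.

End TminusO.

(** * The logarithmic weight *)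

Section LogWeight.
Variable R : realType.

Definition logw (v : R) := 1 - ln (1 + v) / v.

Lemma logw_ge (v : R) : 0 < v -> v / (2 * (1 + v)) <= logw v.
Proof.
move=> v0; rewrite /logw.
pose h (t : R) := t - t ^+ 2 / (2 * (1 + t)) - ln (1 + t).
have dh (t : R) : 0 <= t -> is_derive t 1 h (t ^+ 2 / (2 * (1 + t) ^+ 2)).
  move=> t0; rewrite /h; derive_to.
  - by rewrite gt_eqF//; lra.
  - lra.
  - by rewrite /=; field; rewrite gt_eqF//; lra.
have [||c /andP[c0 cv] H] := @mean_value R h (fun t => t ^+ 2 / (2 * (1 + t) ^+ 2)) 0 v v0.
- by move=> t /andP[t0 _]; apply: is_derive_continuous (dh t t0).
- by move=> t /andP[t0 _]; apply: dh; exact: ltW.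
have h0 : h 0 = 0 by rewrite /h addr0 ln1 expr0n/= mul0r !subr0.
have : 0 <= h v - h 0.
  rewrite H mulr_ge0//; last by rewrite subr0 ltW.
  by rewrite divr_ge0 ?sqr_ge0// mulr_ge0// sqr_ge0.
rewrite h0 subr0 /h => hv.
have -> : v / (2 * (1 + v)) = 1 - (v - v ^+ 2 / (2 * (1 + v))) / v.
  by field; rewrite !gt_eqF//; lra.
rewrite lerD2l lerN2 ler_pM2r ?invr_gt0//; lra.
Qed.

Lemma logw_gt0 (v : R) : 0 < v -> 0 < logw v.
Proof.
move=> v0; apply: lt_le_trans (logw_ge v0).
by rewrite divr_gt0// mulr_gt0//; lra.
Qed.

Lemma logw_le1 (v : R) : 0 <= v -> logw v <= 1.
Proof. by move=> v0; rewrite /logw gerBl divr_ge0// ln_ge0//; lra. Qed.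

Lemma logw_le (v : R) : 0 < v -> logw v <= v.
Proof.
move=> v0; have v1 : 0 < 1 + v by lra.
apply: (@le_trans _ _ (v / (1 + v))); last first.
  by rewrite ler_pdivrMr// ler_peMr ?ltW//; lra.
have L : v / (1 + v) <= ln (1 + v).
  have : ln (1 + - (v / (1 + v))) <= - (v / (1 + v)).
    apply: le_ln1Dx; rewrite ltrN2 ltr_pdivrMr// mul1r; lra.
  have -> : 1 + - (v / (1 + v)) = (1 + v)^-1 by field; rewrite gt_eqF.
  rewrite lnV ?posrE//; lra.
rewrite /logw.
have -> : v / (1 + v) = 1 - v / (1 + v) / v by field; rewrite !gt_eqF.
by rewrite lerD2l lerN2 ler_pM2r ?invr_gt0.
Qed.

Lemma logw_ge0 (v : R) : 0 <= v -> 0 <= logw v.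
Proof.
rewrite le_eqVlt => /predU1P[<-|/logw_gt0/ltW//].
by rewrite /logw invr0 mulr0 subr0.
Qed.

Lemma logw_continuous (v : R) : 0 < v -> {for v, continuous logw}.
Proof.
move=> v0.
suff [a H] : exists a, is_derive v 1 logw a by exact: is_derive_continuous H.
eexists; rewrite /logw; der; [lra|by rewrite gt_eqF].
Qed.

End LogWeight.

(** * Positivity of the first quantity *)

Section Tplus.
Variable R : realType.
Local Notation mu := (@lebesgue_measure R).

Lemma inv_sqrt_continuous (z : R) : z < 1 ->
  {for z, continuous (fun z : R => (Num.sqrt (1 - z))^-1)}.
Proof.
move=> z1; have z0 : 0 < 1 - z by rewrite subr_gt0.
suff [a H] : exists a : R, is_derive z 1 (fun z : R => (Num.sqrt (1 - z))^-1) a.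
  exact: is_derive_continuous H.
by eexists; der => //; rewrite gt_eqF// sqrtr_gt0.
Qed.

(** The function is singular at the upper end, so the half-open interval is
    exhausted by compact ones. *)
Lemma integral_inv_sqrt :
  (\int[mu]_(z in `[0%R, 1%R[) ((Num.sqrt (1 - z))^-1)%:E <= 2%:E)%E.
Proof.
pose F i : set R := `[0%R, (1 - i.+1%:R^-1)%R]%classic.
have i1 i : 0 < i.+1%:R^-1 :> R by rewrite invr_gt0.
have i2 i : i.+1%:R^-1 <= 1 :> R by rewrite invf_le1// ler1n.
have -> : `[0%R, 1%R[%classic = \bigcup_i F i.
  apply/seteqP; split => z /=; rewrite in_itv/=.
    move=> /andP[z0 z1]; have z1' : 0 < 1 - z by rewrite subr_gt0.
    exists (Num.truncn (1 - z)^-1) => //; rewrite /F/= in_itv/= z0/=.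
    rewrite lerBrDr -lerBrDl -[leRHS]invrK lef_pV2 ?posrE ?invr_gt0//.
    by apply: ltW; rewrite truncnS_gt.
  move=> [i _]; rewrite /F/= in_itv/= => /andP[-> z1] /=.
  by apply: le_lt_trans z1 _; rewrite gtrBl.
have wf i : {within F i, continuous (fun z : R => (Num.sqrt (1 - z))^-1)}.
  apply: continuous_in_subspaceT => z; rewrite inE /F/= in_itv/= => /andP[_ z1].
  by apply: inv_sqrt_continuous; apply: le_lt_trans z1 _; rewrite gtrBl.
have mF i : measurable (F i) by exact: measurable_itv.
have H : (\int[mu]_(z in F i) ((Num.sqrt (1 - z))^-1)%:E @[i --> \oo] -->
    \int[mu]_(z in \bigcup_i F i) ((Num.sqrt (1 - z))^-1)%:E)%E.
  apply: ge0_nondecreasing_set_cvg_integral => //.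
  - apply/nondecreasing_seqP => i; apply/subsetPset => z; rewrite /F/= !in_itv/=.
    move=> /andP[-> /le_trans]; apply.
    by rewrite lerD2l lerN2 lef_pV2 ?posrE// ler_nat.
  - move=> i; apply/measurable_EFinP; exact: subspace_continuous_measurable_fun.
rewrite -(cvg_lim (@ereal_hausdorff R) H).
have cH : cvgn (fun i => \int[mu]_(z in F i) ((Num.sqrt (1 - z))^-1)%:E)%E.
  by apply/cvg_ex; eexists; exact: H.
apply: (lime_le cH).
apply: nearW => i.
have [i0|i0] := leP (1 - i.+1%:R^-1) (0 : R).
  rewrite /F; have [->|] := eqVneq (1 - i.+1%:R^-1) (0 : R).
    by rewrite set_itv1 integral_set1 lee_fin.
  move=> n0; rewrite set_itv_ge ?integral_set0 ?lee_fin// bnd_simp -ltNge.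
  by rewrite lt_neqAle n0.
rewrite (@continuous_FTC2 _ _ (fun z => - (2 * Num.sqrt (1 - z))) 0 _ i0).
- rewrite -EFinB lee_fin (subr0 1) sqrtr1.
  by have := sqrtr_ge0 (1 - (1 - i.+1%:R^-1 : R)); lra.
- exact: wf.
- have cG : continuous (fun z : R => - (2 * Num.sqrt (1 - z))) by cont.
  split.
  + move=> z; rewrite in_itv/= => /andP[_ z1].
    have z1' : 0 < 1 - z by rewrite subr_gt0 (lt_trans z1)// gtrBl.
    suff [a []] : exists a, is_derive z 1 (fun z : R => - (2 * Num.sqrt (1 - z))) a by [].
    by eexists; der.
  + exact/cvg_at_right_filter/cG.
  + exact/cvg_at_left_filter/cG.
- move=> z; rewrite in_itv/= => /andP[_ z1].
  have z1' : 0 < 1 - z by rewrite subr_gt0 (lt_trans z1)// gtrBl.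
  rewrite derive1E; apply: derive_val.
  derive_to => //.
  have s0 : 0 < Num.sqrt (1 - z) by rewrite sqrtr_gt0.
  by move: (Num.sqrt _) s0 => S s0; field; rewrite gt_eqF.
Qed.

Variable d : nat.

Definition Tplus_integrand (z : R) :=
  (1 - z ^+ 2) `^ ((d%:R - 3) / 2) * logw (2 ^+ d * z ^+ d).

Lemma TplusE : Tplus R d =
  prefactor R d * fine (\int[mu]_(z in `[0%R, 1%R]) (Tplus_integrand z)%:E)%E.
Proof. by []. Qed.

Lemma Tplus_integrand_continuous (z : R) : 0 < z < 1 ->
  {for z, continuous Tplus_integrand}.
Proof.
move=> /andP[z0 z1]; apply: cvgM.
  suff [a H] : exists a, is_derive z 1 (fun z : R => (1 - z ^+ 2) `^ ((d%:R - 3) / 2)) a.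
    exact: is_derive_continuous H.
  by eexists; der; nra.
apply: (@continuous_comp _ _ _ (fun z : R => 2 ^+ d * z ^+ d) (@logw R)).
  by apply: cont_at; cont.
by apply: logw_continuous; rewrite mulr_gt0 ?exprn_gt0.
Qed.

Lemma Tplus_integrand_measurable :
  measurable_fun (`]0%R, 1%R[%classic : set R) (EFin \o Tplus_integrand).
Proof.
apply/measurable_EFinP; apply: open_continuous_measurable_fun => //.
by move=> z; rewrite inE/= in_itv/=; exact: Tplus_integrand_continuous.
Qed.

Hypothesis d2 : (2 <= d)%N.
Let p : R := (d%:R - 3) / 2.
Let f := Tplus_integrand.

Let dR : 2 <= d%:R :> R. Proof. by rewrite ler_nat. Qed.

Let f_ge0 z : 0 <= z -> 0 <= f z.
Proof. by move=> z0; rewrite mulr_ge0 ?powR_ge0// logw_ge0// mulr_ge0 ?exprn_ge0. Qed.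

(* For d = 2 the exponent is negative, at worst -1/2, whence the singular
   majorant. *)
Let f_le z : 0 <= z < 1 -> f z <= 1 + (Num.sqrt (1 - z))^-1.
Proof.
move=> /andP[z0 z1]; have z1' : 0 < 1 - z by rewrite subr_gt0.
apply: (@le_trans _ _ ((1 - z ^+ 2) `^ p)).
  by rewrite ler_piMr ?powR_ge0// logw_le1// mulr_ge0 ?exprn_ge0.
have y0 : 0 < 1 - z ^+ 2 <= 1 by apply/andP; split; nra.
apply: (@le_trans _ _ ((1 - z ^+ 2) `^ (- 2^-1))).
  by apply: ger_powR => //; rewrite /p; have := dR; lra.
rewrite powRN powR12_sqrt; last by case/andP: y0 => /ltW.
apply: (@le_trans _ _ (Num.sqrt (1 - z))^-1); last by rewrite lerDr.
case/andP: y0 => y0 y1.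
rewrite lef_pV2 ?posrE ?sqrtr_gt0// ler_wsqrtr//; nra.
Qed.

Lemma Tplus_integral_fin : (\int[mu]_(z in `[0%R, 1%R]) (f z)%:E < +oo)%E.
Proof.
have mf := Tplus_integrand_measurable.
have mf1 : measurable_fun (`]0%R, 1%R]%classic : set R) (EFin \o f).
  by rewrite -emeasurable_fun_itv_bndo_bndcP.
rewrite -integral_itv_obnd_cbnd// -integral_itv_bndo_bndc//.
apply: (@le_lt_trans _ _ (\int[mu]_(z in `[0%R, 1%R[) (1 + (Num.sqrt (1 - z))^-1)%:E)%E).
  apply: le_integral_extension => z /=; rewrite !in_itv/= => /andP[z0 z1].
  - by rewrite (ltW z0) z1.
  - by rewrite lee_fin f_ge0// ltW.
  - by rewrite lee_fin addr_ge0// invr_ge0 sqrtr_ge0.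
  - by rewrite lee_fin f_le// (ltW z0).
under eq_integral do rewrite EFinD.
rewrite ge0_integralD//=.
- apply: lte_add_pinfty.
    by rewrite integral_cst//= lebesgue_measure_itv/= lte_fin ltr01 -EFinB -EFinM ltry.
  exact: le_lt_trans integral_inv_sqrt (ltry _).
- apply/measurable_EFinP; apply: subspace_continuous_measurable_fun => //.
  apply: continuous_in_subspaceT => z; rewrite inE/= in_itv/= => /andP[_ z1].
  exact: inv_sqrt_continuous.
Qed.

Lemma Tplus_integral_gt0 : (0 < \int[mu]_(z in `[0%R, 1%R]) (f z)%:E)%E.
Proof.
pose c : R := (3 / 4) `^ (p + 1) * ((1 / 2) ^+ d / 4).
have c0 : 0 < c by rewrite mulr_gt0 ?powR_gt0 ?divr_gt0 ?exprn_gt0//; lra.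
apply: (@lt_le_trans _ _ (c / 4)%:E); first by rewrite lte_fin divr_gt0.
have -> : (c / 4)%:E = (\int[mu]_(z in `[(1 / 4)%R, (1 / 2)%R]) c%:E)%E.
  rewrite integral_cst_itv; last lra.
  by congr EFin; field.
apply: le_integral_extension => z /=; rewrite in_itv/= => /andP[z1 z2].
- by rewrite in_itv/=; lra.
- by rewrite lee_fin ltW.
- by rewrite lee_fin f_ge0.
rewrite lee_fin.
have y1 : 0 < 1 - z ^+ 2 <= 1 by apply/andP; split; nra.
have v1 : (1 / 2) ^+ d <= 2 ^+ d * z ^+ d.
  by rewrite -exprMn lerXn2r ?nnegrE//; lra.
have v2 : 2 ^+ d * z ^+ d <= 1 by rewrite -exprMn exprn_ile1//; lra.
have h0 : 0 < (1 / 2 : R) ^+ d by rewrite exprn_gt0.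
apply: ler_pM; rewrite ?powR_ge0 ?divr_ge0 ?(ltW h0)//.
  apply: (@le_trans _ _ ((1 - z ^+ 2) `^ (p + 1))).
    apply: ge0_ler_powR; rewrite ?nnegrE /p; [have := dR; lra|lra| |nra].
    by case/andP: y1 => /ltW.
  by apply: ger_powR => //; rewrite lerDl.
move: (2 ^+ d * z ^+ d) ((1 / 2) ^+ d) v1 v2 h0 => v h v1 v2 h0.
have v0 : 0 < v by lra.
apply: le_trans (logw_ge v0).
rewrite ler_pdivrMr// mulrAC ler_pdivlMr; nra.
Qed.

Lemma Tplus_gt0 : 0 < Tplus R d.
Proof.
rewrite TplusE mulr_gt0 ?prefactor_gt0// fine_gt0//.
by rewrite Tplus_integral_gt0 Tplus_integral_fin.
Qed.

End Tplus.

(** * The limit integral *)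

Section LimitIntegral.
Variable R : realType.
Local Notation mu := (@lebesgue_measure R).
Local Notation r3 := (Num.sqrt 3 : R).

(** The pointwise limit of the rescaled integrands, see [rescaled_cvg]. *)
Definition limit_integrand (x : R) := (x ^+ 2)^-1 * logw (x ^+ 3).

Lemma limit_integrand_continuous (x : R) : 0 < x ->
  {for x, continuous limit_integrand}.
Proof.
move=> x0; apply: cvgM.
  by apply: cvgV; [rewrite expf_neq0// gt_eqF|exact: exprn_continuous].
apply: (@continuous_comp _ _ _ (fun x : R => x ^+ 3) (@logw R)).
  exact: exprn_continuous.
by apply: logw_continuous; rewrite exprn_gt0.
Qed.

Lemma limit_integrand_measurable :
  measurable_fun (`]0%R, +oo[%classic : set R) (EFin \o limit_integrand).
Proof.
apply/measurable_EFinP; apply: open_continuous_measurable_fun => //.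
by move=> x; rewrite inE/= in_itv/= andbT; exact: limit_integrand_continuous.
Qed.

(* A primitive of x / (1 + x^3), by partial fractions. *)
Let Psi (x : R) := - (3^-1 * ln (1 + x)) + 6^-1 * ln (x ^+ 2 - x + 1)
   + r3^-1 * atan ((2 * x - 1) / r3).

(* A primitive of limit_integrand: integrating x^-2 - x^-5 * ln (1 + x^3) by
   parts leaves 3/4 times the integral of x / (1 + x^3). *)
Let prim_limit (x : R) := - (4^-1 * (logw (x ^+ 3) / x)) + 3 / 4 * Psi x.

Let quad_gt0 (x : R) : 0 < x ^+ 2 - x + 1.
Proof. nra. Qed.

(** The angle has cosine [r3 / 2], so the cosine of its triple vanishes. *)
Lemma atan_inv_sqrt3 : atan (r3^-1) = pi / 6.
Proof.
have r30 := sqrt3_gt0 R; have r32 := sqrt3_sqr R.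
set al := atan _.
have a0 : 0 < al by rewrite -(atan0 R); apply: lt_atan; rewrite invr_gt0.
have a1 : al <= pi / 4.
  rewrite -(atan1 R); apply: le_atan; rewrite invf_le1//; nra.
have ca : cos al = r3 / 2.
  rewrite cos_atan exprVn r32.
  have -> : 1 + 3^-1 = (2 / r3) ^+ 2 :> R by rewrite expr_div_n r32; field.
  by rewrite sqrtr_sqr ger0_norm ?divr_ge0 ?ltW// invf_div.
have c3 : cos (al *+ 2 + al) = 0.
  rewrite cosD cos_mulr2n sin_mulr2n ca.
  have -> : (r3 / 2 * sin al) *+ 2 * sin al = r3 * (1 - (r3 / 2) ^+ 2).
    by rewrite -ca -sin2cos2 ca mulr2n; field.
  by rewrite mulr2n; move: r3 r32 => r E; field: E.
have E : al *+ 2 + al = pi / 2.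
  have pi0 := pi_gt0 R.
  apply: cos_inj; rewrite ?c3 ?cos_pihalf//.
    by rewrite in_itv/= -mulr_natr; lra.
  by rewrite in_itv/=; lra.
by move: E; rewrite -mulr_natr => E; lra.
Qed.

Let Psi_derive (x : R) : 0 <= x -> is_derive x 1 Psi (x / (1 + x ^+ 3)).
Proof.
move=> x0; have r30 := sqrt3_gt0 R; have r32 := sqrt3_sqr R.
have q0 := quad_gt0 x.
rewrite /Psi; derive_to => //; first by lra.
have x1 : 0 < 1 + x by lra.
have -> : 1 + x ^+ 3 = (1 + x) * (x ^+ 2 - x + 1) by ring.
have -> : 1 + ((2 * x - 1) / r3) ^+ 2 = 4 / 3 * (x ^+ 2 - x + 1).
  by rewrite expr_div_n r32; field.
have E : r3^-1 * ((4 / 3 * (x ^+ 2 - x + 1))^-1 *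
    ((2 * x - 1) * 0 + r3^-1 * (2 * 1 + x * 0 - 0))) = (2 * (x ^+ 2 - x + 1))^-1.
  have H A : r3^-1 * (A * ((2 * x - 1) * 0 + r3^-1 * (2 * 1 + x * 0 - 0))) =
      A * 2 / r3 ^+ 2 by field; rewrite gt_eqF.
  by rewrite H r32; field; rewrite gt_eqF.
by rewrite E /=; field; rewrite !gt_eqF.
Qed.

Let logw_derive (v : R) : 0 < v ->
  is_derive v 1 (@logw R) (ln (1 + v) / v ^+ 2 - (v * (1 + v))^-1).
Proof.
move=> v0; rewrite /logw; derive_to; first by lra.
  by rewrite gt_eqF.
by rewrite /=; field; rewrite !gt_eqF//; lra.
Qed.

Let prim_limit_derive (x : R) : 0 < x ->
  is_derive x 1 prim_limit (limit_integrand x).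
Proof.
move=> x0; have v0 : 0 < x ^+ 3 by rewrite exprn_gt0.
rewrite /prim_limit; derive_eq.
  notypeclasses refine (derD _ _); last first.
    by notypeclasses refine (derM (der_cst _ _) (Psi_derive _)); exact: ltW.
  notypeclasses refine (derN (derM (der_cst _ _) (derM _ (derV (der_id _) _)))).
    exact: (der_comp (derX (der_id x) 3) (logw_derive v0)).
  by rewrite gt_eqF.
rewrite /limit_integrand /logw /=.
by field; rewrite !gt_eqF//; lra.
Qed.

(* The quotient whose logarithm combines the two logarithms of Psi. *)
Let psi_quot_cvg : (x ^+ 2 - x + 1) / (1 + x) ^+ 2 @[x --> +oo] --> (1 : R).
Proof.
have H : 1 - 3 * ((1 + x)^-1 - ((1 + x)^-1) ^+ 2) @[x --> +oo] --> (1 - 3 * (0 - 0 ^+ 2) : R).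
  have i0 : (1 + x)^-1 @[x --> +oo] --> (0 : R).
    apply: (@cvg_comp _ _ _ (fun x : R => 1 + x) (fun x => x^-1) _ (+oo)); last exact: cvgV_infty.
    apply/cvgryPge => A; near=> u.
    have Au : A <= u by near: u; apply: nbhs_pinfty_ge; exact: num_real.
    lra.
  apply: cvgB; first exact: cvg_cst.
  apply: cvgM; first exact: cvg_cst.
  apply: cvgB; first exact: i0.
  rewrite !expr2; under eq_fun do rewrite expr2.
  exact: cvgM.
rewrite expr0n/= subr0 mulr0 subr0 in H.
apply: cvg_trans H; apply: near_eq_cvg; near=> x.
have x0 : 0 < x by near: x; exact: nbhs_pinfty_gt.
by field; rewrite gt_eqF//; lra.
Unshelve. all: by end_near. Qed.

Let Psi_cvg : Psi x @[x --> +oo] --> r3^-1 * (pi / 2).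
Proof.
have r30 := sqrt3_gt0 R.
have H : 6^-1 * ln ((x ^+ 2 - x + 1) / (1 + x) ^+ 2) + r3^-1 * atan ((2 * x - 1) / r3)
    @[x --> +oo] --> 6^-1 * ln 1 + r3^-1 * (pi / 2).
  apply: cvgD; apply: cvgM; try exact: cvg_cst.
    by apply: continuous_cvg psi_quot_cvg; apply: continuous_ln.
  apply: (@cvg_comp _ _ _ (fun x : R => (2 * x - 1) / r3) atan _ (+oo)); last exact: cvgy_atan.
  apply/cvgryPge => A; near=> u.
  have Au : (A * r3 + 1) / 2 <= u by near: u; apply: nbhs_pinfty_ge; exact: num_real.
  rewrite ler_pdivlMr//; lra.
rewrite ln1 mulr0 add0r in H.
apply: cvg_trans H; apply: near_eq_cvg; near=> x.
have x0 : 0 < x by near: x; exact: nbhs_pinfty_gt.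
have x1 : 0 < 1 + x by lra.
rewrite /Psi ln_div ?posrE ?quad_gt0 ?exprn_gt0// lnXn//.
by rewrite -mulr_natr; congr (_ + _); field.
Unshelve. all: by end_near. Qed.

Let tail_cvg_infty : 4^-1 * (logw (x ^+ 3) / x) @[x --> +oo] --> (0 : R).
Proof.
rewrite -(mulr0 4^-1); apply: cvgM; first exact: cvg_cst.
apply: (@squeeze_cvgr _ _ _ _ (fun=> 0) (fun x => x^-1)).
- near=> x; have x0 : 0 < x by near: x; exact: nbhs_pinfty_gt.
  have v0 : 0 <= x ^+ 3 by rewrite exprn_ge0// ltW.
  by rewrite divr_ge0 ?logw_ge0 ?(ltW x0)//= ler_piMl ?invr_ge0 ?(ltW x0)// logw_le1.
- exact: cvg_cst.
- exact: cvgV_infty.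
Unshelve. all: by end_near. Qed.

Let logw_small (x : R) : 0 < x -> 0 <= logw (x ^+ 3) <= x ^+ 3.
Proof.
by move=> x0; rewrite logw_ge0 ?logw_le ?exprn_gt0// ltW// exprn_gt0.
Qed.

Let right_id (c : R) : (x : R) @[x --> c^'+] --> c.
Proof. by apply: cvg_at_right_filter; exact: cvg_id. Qed.

Let limit_integrand_right : limit_integrand x @[x --> 0^'+] --> limit_integrand 0.
Proof.
have -> : limit_integrand 0 = 0 by rewrite /limit_integrand expr0n/= invr0 mul0r.
apply: (@squeeze_cvgr _ _ _ _ (fun=> 0) (fun x => x)).
- near=> x; have x0 : 0 < x by near: x; exact: nbhs_right_gt.
  have /andP[l0 l1] := logw_small x0.
  rewrite /limit_integrand mulr_ge0 ?invr_ge0 ?sqr_ge0//=.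
  rewrite mulrC ler_pdivrMr ?exprn_gt0//; by rewrite -exprS.
- exact: cvg_cst.
- exact: right_id.
Unshelve. all: by end_near. Qed.

Let prim_limit_right : prim_limit x @[x --> 0^'+] --> prim_limit 0.
Proof.
apply: cvgD; last first.
  apply: cvgM; first exact: cvg_cst.
  by apply: cvg_at_right_filter; apply: is_derive_continuous (Psi_derive _).
apply: cvgN; apply: cvgM; first exact: cvg_cst.
rewrite invr0 mulr0.
apply: (@squeeze_cvgr _ _ _ _ (fun=> 0) (fun x => x ^+ 2)).
- near=> x; have x0 : 0 < x by near: x; exact: nbhs_right_gt.
  have /andP[l0 l1] := logw_small x0.
  rewrite divr_ge0 ?(ltW x0)//= ler_pdivrMr//; by rewrite -exprSr.
- exact: cvg_cst.
- have c2 : continuous (fun x : R => x ^+ 2) by cont.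
  by have := cvg_at_right_filter (c2 0); rewrite expr0n.
Unshelve. all: by end_near. Qed.

Lemma limit_integral :
  (\int[mu]_(x in `]0%R, +oo[) (limit_integrand x)%:E = (pi / (2 * r3))%:E)%E.
Proof.
have r30 := sqrt3_gt0 R; have r32 := sqrt3_sqr R.
rewrite integral_itv_obnd_cbnd; last exact: limit_integrand_measurable.
rewrite (@ge0_continuous_FTC2y _ limit_integrand prim_limit 0 (3 / 4 * (r3^-1 * (pi / 2)))).
- rewrite -EFinB; congr EFin.
  have P0 : Psi 0 = - (r3^-1 * (pi / 6)).
    rewrite /Psi (_ : (2 * 0 - 1) / r3 = - r3^-1); last by ring.
    rewrite (_ : 0 ^+ 2 - 0 + 1 = 1 :> R); last by ring.
    by rewrite addr0 ln1 atanN atan_inv_sqrt3; ring.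
  rewrite /prim_limit invr0 !mulr0 P0.
  by move: (pi : R) => P; field; rewrite gt_eqF.
- move=> x x0; rewrite mulr_ge0 ?invr_ge0 ?sqr_ge0//.
  by rewrite logw_ge0 ?exprn_ge0.
- apply/continuous_within_itvcyP; split; last exact: limit_integrand_right.
  by move=> x; rewrite in_itv/= andbT; exact: limit_integrand_continuous.
- rewrite -[X in _ --> X]add0r -oppr0; apply: cvgD.
    by apply: cvgN; exact: tail_cvg_infty.
  by apply: cvgM; [exact: cvg_cst|exact: Psi_cvg].
- by move=> x /prim_limit_derive [].
- exact: prim_limit_right.
- move=> x; rewrite in_itv/= andbT => /prim_limit_derive H.
  by rewrite derive1E derive_val.
Qed.

End LimitIntegral.

(** * Rescaling the first quantity at its peak *)

Section Rescaled.
Variable R : realType.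
Local Notation mu := (@lebesgue_measure R).

(** The integrand of [Tplus] in the variable [x = (2 z)^(d/3)], without the
    constant of [Tplus_rescaled]. The truncation in [powRpos] makes it vanish
    beyond the image [2^(d/3)] of [z = 1], so that the integral can be taken
    over the whole half-line. *)
Definition rescaled (d : nat) (x : R) :=
  x `^ (3 / d%:R - 1) *
  powRpos ((d%:R - 3) / 2) ((4 - x `^ (6 / d%:R)) / 3) * logw (x ^+ 3).

Section FixedDim.
Variable d : nat.
Hypothesis d4 : (4 <= d)%N.

Let dR : 4 <= d%:R :> R. Proof. by rewrite ler_nat. Qed.
Let d0 : 0 < d%:R :> R. Proof. by apply: lt_le_trans dR. Qed.
Let p : R := (d%:R - 3) / 2.
Let p0 : 0 < p. Proof. by rewrite /p; have := dR; lra. Qed.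

Lemma rescaled_continuous (x : R) : 0 < x -> {for x, continuous (rescaled d)}.
Proof.
move=> x0.
have cp q : {for x, continuous (fun t : R => t `^ q)}.
  exact: (is_derive_continuous (@der_powR R (fun t => t) x 1 (der_id x) q x0)).
apply: cvgM; first apply: cvgM; first exact: cp.
  apply: (@continuous_comp _ _ _ (fun t : R => (4 - t `^ (6 / d%:R)) / 3) (powRpos p)).
    apply: cvgM; last exact: cvg_cst.
    by apply: cvgB; [exact: cvg_cst|exact: cp].
  by apply: continuous_powRpos; exact: ltW.
apply: (@continuous_comp _ _ _ (fun x : R => x ^+ 3) (@logw R)).
  exact: exprn_continuous.
by apply: logw_continuous; rewrite exprn_gt0.
Qed.

Lemma rescaled_measurable :
  measurable_fun (`]0%R, +oo[%classic : set R) (EFin \o rescaled d).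
Proof.
apply/measurable_EFinP; apply: open_continuous_measurable_fun => //.
by move=> x; rewrite inE/= in_itv/= andbT; exact: rescaled_continuous.
Qed.

Lemma rescaled_ge0 (x : R) : 0 <= x -> 0 <= rescaled d x.
Proof.
by move=> x0; rewrite !mulr_ge0 ?powR_ge0 ?powRpos_ge0// logw_ge0// exprn_ge0.
Qed.

(** Weighted arithmetic and geometric means: with [y = x^(6/d)],
    [1 = 3/4 * ((4 - y) / 3) + 1/4 * y >= ((4 - y) / 3)^(3/4) * y^(1/4)]. *)
Lemma powRpos_amgm (x : R) : 0 < x ->
  powRpos p ((4 - x `^ (6 / d%:R)) / 3) <= x `^ (3 / d%:R - 1).
Proof.
move=> x0; have [y0|y0] := leP ((4 - x `^ (6 / d%:R)) / 3) 0.
  by rewrite /powRpos max_r// powR0 ?gt_eqF// powR_ge0.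
rewrite powRposE ?(ltW y0)//.
have ye : x `^ (6 / d%:R) = expR (6 / d%:R * ln x) by rewrite /powR gt_eqF.
have -> : ((4 - x `^ (6 / d%:R)) / 3) `^ p =
    expR (p * ln ((4 - x `^ (6 / d%:R)) / 3)) by rewrite {1}/powR gt_eqF.
rewrite [leRHS]/powR gt_eqF// ler_expR.
have H : ln ((4 - x `^ (6 / d%:R)) / 3) <= - (2 / d%:R * ln x).
  set y := (4 - _) / 3 in y0 *.
  have yE : y = 1 + (y - 1) by ring.
  rewrite yE; apply: (le_trans (le_ln1Dx _)); first by lra.
  have := expR_ge1Dx (6 / d%:R * ln x); rewrite -ye /y; lra.
apply: (@le_trans _ _ (p * - (2 / d%:R * ln x))); first by rewrite ler_pM2l.
rewrite le_eqVlt; apply/orP; left; apply/eqP.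
by rewrite /p; field; rewrite gt_eqF.
Qed.

Lemma rescaled_le (x : R) : 0 < x ->
  rescaled d x <= x `^ (6 / d%:R - 2) * logw (x ^+ 3).
Proof.
move=> x0; rewrite /rescaled ler_wpM2r ?logw_ge0 ?exprn_ge0 ?(ltW x0)//.
apply: (@le_trans _ _ (x `^ (3 / d%:R - 1) * x `^ (3 / d%:R - 1))).
  by rewrite ler_wpM2l ?powR_ge0// powRpos_amgm.
rewrite -powRD ?(gt_eqF x0) ?implybT//.
by rewrite (_ : 3 / d%:R - 1 + (3 / d%:R - 1) = 6 / d%:R - 2); [|ring].
Qed.

Lemma rescaled_le_small (x : R) : 0 < x -> x <= 1 -> rescaled d x <= x.
Proof.
move=> x0 x1; apply: le_trans (rescaled_le x0) _.
apply: (@le_trans _ _ (x `^ (6 / d%:R - 2) * x ^+ 3)).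
  by rewrite ler_wpM2l ?powR_ge0// logw_le// exprn_gt0.
rewrite -powR_mulrn ?(ltW x0)// -powRD ?(gt_eqF x0) ?implybT//.
rewrite -[leRHS]powRr1 ?(ltW x0)//; apply: ger_powR; first by rewrite x0.
have : 0 <= 6 / d%:R :> R by rewrite divr_ge0// ltW.
lra.
Qed.

(** Near [0] the weight [logw (x^3) <= x^3] makes [rescaled] bounded by [1]; beyond
    [1] it is at most [x^(6/d - 2)], which is at most [x^(-3/2)] as soon as
    [12 <= d]. *)
Lemma rescaled_dom (x : R) : (12 <= d)%N -> 0 < x -> rescaled d x <= 3 * dom x.
Proof.
move=> d12 x0; have [x1|x1] := leP x 1.
  have H := dom_ge_small (ltW x0) x1.
  by apply: le_trans H; apply: (le_trans (rescaled_le_small x0 x1)).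
apply: le_trans (dom_ge_big (ltW x1)); apply: le_trans (rescaled_le x0) _.
have -> : (x * Num.sqrt x)^-1 = x `^ (- (3 / 2)).
  have -> : - (3 / 2) = - (1 + 2^-1) :> R by field.
  rewrite powRN powRD ?(gt_eqF x0) ?implybT//.
  by rewrite powRr1 ?(ltW x0)// powR12_sqrt// ltW.
apply: (@le_trans _ _ (x `^ (6 / d%:R - 2))).
  by rewrite ler_piMr ?powR_ge0// logw_le1// exprn_ge0// ltW.
apply: ler_powR; first exact: ltW.
have : 6 / d%:R <= 2^-1 :> R.
  rewrite ler_pdivrMr//; have : 12 <= d%:R :> R by rewrite (ler_nat _ 12).
  lra.
lra.
Qed.

Lemma rescaled0 : rescaled d 0 = 0.
Proof.
rewrite /rescaled powR0 ?mul0r//.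
rewrite subr_eq0 lt_eqF// ltr_pdivrMr//; have := dR; lra.
Qed.

Let X : R := 2 `^ (d%:R / 3).

Let X0 : 0 < X. Proof. exact: powR_gt0. Qed.

Lemma rescaled_eq0 (x : R) : X < x -> rescaled d x = 0.
Proof.
move=> Xx; have x0 := lt_trans X0 Xx.
have H : 4 < x `^ (6 / d%:R).
  have -> : 4 = X `^ (6 / d%:R).
    rewrite /X -powRrM (_ : _ / 3 * _ = 2%:R); last by field; rewrite gt_eqF.
    by rewrite powR_mulrn// -natrX.
  by apply: gt0_ltr_powR; rewrite ?nnegrE ?divr_gt0 ?(ltW X0) ?(ltW x0).
by rewrite /rescaled /powRpos max_r ?powR0 ?gt_eqF// ?mulr0 ?mul0r//; lra.
Qed.

Lemma integral_rescaled (k : R) :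
  (\int[mu]_(x in `[0%R, X]) (k * rescaled d x)%:E =
   \int[mu]_(x in `]0%R, +oo[) (k * rescaled d x)%:E)%E.
Proof.
rewrite integral_mkcond [RHS]integral_mkcond; congr (integral _ _ _).
apply/funext => x; rewrite !patchE !mem_setE !in_itv/= andbT.
have [->|xn0] := eqVneq x 0.
  by rewrite ltxx lexx (ltW X0)/= rescaled0 mulr0.
rewrite [0 < x]lt_neqAle eq_sym xn0/=.
by have [xX|/rescaled_eq0 ->] := leP x X; rewrite ?andbT// andbF mulr0 if_same.
Qed.

(* The substitution x = (2 z)^(d/3) and its derivative. *)
Let phi (z : R) := powRpos (d%:R / 3) (2 * z).
Let psi (z : R) := 2 * d%:R / 3 * powRpos (d%:R / 3 - 1) (2 * z).

Let phi_cont : continuous phi.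
Proof. by rewrite /phi; cont; rewrite divr_ge0// ltW. Qed.

Let psi_cont : continuous psi.
Proof. by rewrite /psi; cont; have := dR; lra. Qed.

Let phi_derive (z : R) : 0 < z -> is_derive z 1 phi (psi z).
Proof.
move=> z0.
apply: (@near_eq_is_derive R R R (fun u : R => (2 * u) `^ (d%:R / 3)) phi z 1 (psi z)).
  near=> y; rewrite /phi powRposE// mulr_ge0// ltW//; near: y; exact: lt_nbhsr.
derive_eq.
  have dw : is_derive z 1 (fun u : R => 2 * u) (2 * 1 + z * 0) := derM (der_cst z 2) (der_id z).
  by apply: (@der_powR _ _ _ _ dw); rewrite mulr_gt0.
by rewrite /psi powRposE ?mulr_ge0 ?(ltW z0)//; ring.
Unshelve. all: by end_near. Qed.

Let phi'E (z : R) : 0 < z -> derive1 phi z = psi z.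
Proof. by move=> /phi_derive H; rewrite derive1E derive_val. Qed.

Let phi'_cont (z : R) : 0 < z -> {for z, continuous (derive1 phi)}.
Proof.
move=> z0; rewrite /prop_for /continuous_at phi'E//.
have H : psi x @[x --> z] --> psi z := psi_cont (x := z).
apply: cvg_trans H; apply: near_eq_cvg; near=> y.
by rewrite phi'E//; near: y; exact: lt_nbhsr.
Unshelve. all: by end_near. Qed.

Let C : R := 3 / (2 * d%:R) * (3 / 4) `^ p.

Let change_of_variable (z : R) : 0 < z < 1 ->
  C * rescaled d (phi z) * psi z = Tplus_integrand d z.
Proof.
move=> /andP[z0 z1].
have w0 : 0 < 2 * z by rewrite mulr_gt0.
have y0 : 0 < 1 - z ^+ 2 by nra.
rewrite /phi /psi !powRposE ?(ltW w0)// /rescaled /C /Tplus_integrand.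
rewrite -powRrM -[(2 * z) `^ _ `^ (6 / _)]powRrM.
have -> : d%:R / 3 * (6 / d%:R) = 2%:R :> R by field; rewrite gt_eqF.
rewrite [(2 * z) `^ 2%:R]powR_mulrn ?(ltW w0)//.
have -> : ((2 * z) `^ (d%:R / 3)) ^+ 3 = 2 ^+ d * z ^+ d.
  rewrite -powR_mulrn ?powR_ge0// -powRrM divfK// powR_mulrn ?(ltW w0)//.
  by rewrite exprMn.
have -> : (4 - (2 * z) ^+ 2) / 3 = (3 / 4)^-1 * (1 - z ^+ 2) by field.
rewrite powRposE ?mulr_ge0 ?invr_ge0 ?(ltW y0)//.
rewrite -/p [((3 / 4)^-1 * _) `^ p]powRM ?invr_ge0 ?(ltW y0)//.
have E1 : (3 / 4 : R) `^ p * (3 / 4)^-1 `^ p = 1.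
  by rewrite -powRM// divff ?powR1//.
have E2 : (2 * z) `^ (d%:R / 3 * (3 / d%:R - 1)) * (2 * z) `^ (d%:R / 3 - 1) = 1.
  rewrite -powRD ?(gt_eqF w0) ?implybT//.
  by rewrite (_ : _ + _ = 0) ?powRr0//; field; rewrite gt_eqF.
have E3 : 3 / (2 * d%:R) * (2 * d%:R / 3) = 1 :> R by field; rewrite gt_eqF.
move: (logw _) ((1 - z ^+ 2) `^ p) => L Q.
move: ((2 * z) `^ _) ((2 * z) `^ _) E2 => A B E2.
move: ((3 / 4) `^ p) ((3 / 4)^-1 `^ p) E1 => U V E1.
move: (3 / (2 * _)) (2 * d%:R / 3) E3 => S T E3.
have -> : S * U * (B * (V * Q) * L) * (T * A) = (S * T) * (U * V) * (B * A) * (Q * L).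
  by ring.
by rewrite E1 E2 E3 !mul1r.
Qed.

(* At the ends z = 0 and z = 1 the substituted integrand may differ from the
   original one. *)
Let eq_integral_oo (f g : R -> R) :
  measurable_fun (`]0%R, 1%R[%classic : set R) (EFin \o f) ->
  (forall z, 0 < z < 1 -> f z = g z) ->
  (\int[mu]_(z in `[0%R, 1%R]) (f z)%:E = \int[mu]_(z in `[0%R, 1%R]) (g z)%:E)%E.
Proof.
move=> mf fg.
have mg : measurable_fun (`]0%R, 1%R[%classic : set R) (EFin \o g).
  apply: eq_measurable_fun mf => z; rewrite inE/= in_itv/= => /fg E.
  by rewrite /= E.
have oc h : measurable_fun (`]0%R, 1%R[%classic : set R) (EFin \o h) ->
  (\int[mu]_(z in `[0%R, 1%R]) (h z)%:E = \int[mu]_(z in `]0%R, 1%R[) (h z)%:E)%E.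
  move=> mh; have mh1 : measurable_fun (`]0%R, 1%R]%classic : set R) (EFin \o h).
    by rewrite -emeasurable_fun_itv_bndo_bndcP.
  by rewrite -integral_itv_obnd_cbnd// -integral_itv_bndo_bndc.
rewrite (oc _ mf) (oc _ mg); apply: eq_integral => z; rewrite inE/= in_itv/=.
by move=> /fg ->.
Qed.

Lemma rescaled_right : rescaled d x @[x --> 0^'+] --> rescaled d 0.
Proof.
rewrite rescaled0.
apply: (@squeeze_cvgr _ _ _ _ (fun=> 0) (fun x => x)).
- near=> x; have x0 : 0 < x by near: x; exact: nbhs_right_gt.
  rewrite rescaled_ge0 ?(ltW x0)//=; apply: rescaled_le_small => //.
  by near: x; apply: nbhs_right_le.
- exact: cvg_cst.
- by apply: cvg_at_right_filter; exact: cvg_id.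
Unshelve. all: by end_near. Qed.

Lemma Tplus_rescaled :
  (\int[mu]_(z in `[0%R, 1%R]) (Tplus_integrand d z)%:E =
   (3 / (2 * d%:R) * (3 / 4) `^ ((d%:R - 3) / 2))%:E *
   \int[mu]_(x in `]0%R, +oo[) (rescaled d x)%:E)%E.
Proof.
rewrite -/p -/C.
have C0 : 0 <= C by rewrite mulr_ge0 ?powR_ge0// divr_ge0// mulr_ge0.
rewrite -ge0_integralZl_EFin//; last 2 first.
- by move=> x; rewrite /= in_itv/= andbT => x0; rewrite lee_fin rescaled_ge0// ltW.
- exact: rescaled_measurable.
have phi0 : phi 0 = 0 by rewrite /phi mulr0 powRpos0// divr_gt0.
have phi1 : phi 1 = X by rewrite /phi mulr1 powRposE.
transitivity (\int[mu]_(x in `[0%R, X]) (C * rescaled d x)%:E)%E; last exact: integral_rescaled.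
have := @integration_by_substitution_increasing R phi
  (fun x => C * rescaled d x) 0 1.
rewrite phi0 phi1 => ->//.
- apply: eq_integral_oo; first exact: Tplus_integrand_measurable.
  move=> z zI; rewrite -change_of_variable// /GRing.mul/= phi'E//.
  by case/andP: zI.
- move=> x y; rewrite !in_itv/= => /andP[x0 _] /andP[y0 _] xy.
  rewrite /phi !powRposE ?mulr_ge0//.
  by apply: gt0_ltr_powR; rewrite ?nnegrE ?mulr_ge0 ?divr_gt0 ?ltr_pM2l.
- by move=> z; rewrite in_itv/= => /andP[z0 _]; exact: phi'_cont.
- apply/cvg_ex; exists (psi 0).
  have H : psi x @[x --> 0^'+] --> psi 0 := cvg_at_right_filter (psi_cont (x := 0)).
  apply: cvg_trans H; apply: near_eq_cvg; near=> y.
  by rewrite phi'E//; near: y; exact: nbhs_right_gt.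
- apply/cvg_ex; exists (psi 1).
  have H : psi x @[x --> 1^'-] --> psi 1 := cvg_at_left_filter (psi_cont (x := 1)).
  apply: cvg_trans H; apply: near_eq_cvg; near=> y.
  by rewrite phi'E//; near: y; exact: nbhs_left_gt.
- split.
  + by move=> z; rewrite in_itv/= => /andP[/phi_derive []].
  + exact: cvg_at_right_filter (phi_cont (x := 0)).
  + exact: cvg_at_left_filter (phi_cont (x := 1)).
- apply/continuous_within_itvP => //; split.
  + move=> x; rewrite in_itv/= => /andP[x0 _].
    by apply: cvgM; [exact: cvg_cst|exact: rescaled_continuous].
  + by apply: cvgM; [exact: cvg_cst|exact: rescaled_right].
  + apply: cvgM; first exact: cvg_cst.
    by apply: cvg_at_left_filter; exact: rescaled_continuous.
Unshelve. all: by end_near. Qed.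

End FixedDim.
End Rescaled.

(** * Asymptotics of the first quantity *)

Section Asymptotics.
Variable R : realType.
Local Notation mu := (@lebesgue_measure R).
Local Notation r3 := (Num.sqrt 3 : R).

Lemma cvg_invn : (d%:R^-1 : R) @[d --> \oo] --> (0 : R).
Proof. by rewrite -(cvg_shiftn 1); under eq_fun do rewrite addn1; exact: cvg_harmonic. Qed.

(** The difference quotients along [1/d], the form in which derivatives at [0]
    enter the pointwise limit of [rescaled]. *)
Lemma cvg_secant (f : R -> R) (a : R) : f 0 = 0 -> is_derive (0 : R) 1 f a ->
  d%:R * f d%:R^-1 @[d --> \oo] --> a.
Proof.
move=> f0 [df fa].
have H : (h^-1 *: (f (h *: 1 + 0) - f 0)) @[h --> (0 : R)^'] --> a.
  by rewrite -fa; exact: df.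
have e0 : (d%:R^-1 : R) @[d --> \oo] --> (0 : R)^'.
  move=> A /= A0.
  have B : \forall d \near \oo, (d%:R^-1 : R) != 0 -> A (d%:R^-1).
    by apply: cvg_invn A0.
  have C : \forall d \near \oo, A (d%:R^-1).
    near=> d.
    have d0 : (0 < d)%N by near: d; exact: nbhs_infty_gt.
    have : (d%:R^-1 : R) != 0 -> A (d%:R^-1) by near: d.
    by apply; rewrite invr_eq0 pnatr_eq0 -lt0n.
  exact: C.
have := cvg_comp _ _ e0 H; apply: cvg_trans; apply: near_eq_cvg; near=> d.
by rewrite /= invrK f0 subr0 addr0 [_ *: 1]mulr1.
Unshelve. all: by end_near. Qed.

(** With [psi h = ln ((4 - x^(6 h)) / 3)] the middle factor of [rescaled] is
    [exp ((d - 3) / 2 * psi (1/d))]. As [psi 0 = 0] and [psi' 0 = - 2 * ln x], the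
    exponent tends to [- ln x]. *)
Lemma rescaled_cvg (x : R) : 0 < x ->
  rescaled d x @[d --> \oo] --> limit_integrand x.
Proof.
move=> x0; set L := ln x.
have powE q : x `^ q = expR (q * L) by rewrite /powR gt_eqF.
have exp_cvg (u : nat -> R) (l : R) : u d @[d --> \oo] --> l ->
    expR (u d) @[d --> \oo] --> expR l.
  by move=> ul; apply: continuous_cvg ul; exact: continuous_expR.
have lin k : k / d%:R * L @[d --> \oo] --> (0 : R).
  rewrite -(mul0r L); apply: cvgM; last exact: cvg_cst.
  by rewrite -(mulr0 k); apply: cvgM; [exact: cvg_cst|exact: cvg_invn].
have H1 : x `^ (3 / d%:R - 1) @[d --> \oo] --> x^-1.
  under eq_fun do rewrite powE mulrBl mul1r.
  have -> : x^-1 = expR (0 - L) by rewrite sub0r expRN lnK ?posrE.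
  by apply: exp_cvg; apply: cvgB; [exact: lin|exact: cvg_cst].
pose psi h := ln ((4 - expR (6 * L * h)) / 3).
have psi0 : psi 0 = 0.
  by rewrite /psi mulr0 expR0 (_ : (4 - 1) / 3 = 1) ?ln1//; field.
have dpsi : is_derive (0 : R) 1 psi (- (2 * L)).
  rewrite /psi; derive_to.
    by rewrite mulr0 expR0; lra.
  by rewrite mulr0 expR0; field.
have y1 : x `^ (6 / d%:R) @[d --> \oo] --> (1 : R).
  under eq_fun do rewrite powE.
  have := exp_cvg _ _ (lin 6); rewrite expR0; exact.
have H2 : powRpos ((d%:R - 3) / 2) ((4 - x `^ (6 / d%:R)) / 3) @[d --> \oo] --> x^-1.
  have -> : x^-1 = expR (2^-1 * - (2 * L) * (1 - 3 * 0)).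
    by rewrite -[x in LHS]lnK ?posrE// -expRN; congr expR; rewrite /L; field.
  have H : expR (2^-1 * (d%:R * psi d%:R^-1) * (1 - 3 * d%:R^-1)) @[d --> \oo] -->
      expR (2^-1 * - (2 * L) * (1 - 3 * 0)).
    apply: exp_cvg; apply: cvgM.
      by apply: cvgM; [exact: cvg_cst|exact: cvg_secant].
    apply: cvgB; first exact: cvg_cst.
    by apply: cvgM; [exact: cvg_cst|exact: cvg_invn].
  apply: cvg_trans H; apply: near_eq_cvg; near=> d.
  have d0 : (0 < d)%N by near: d; exact: nbhs_infty_gt.
  have y4 : x `^ (6 / d%:R) < 4.
    by near: d; have /cvgr_lt := y1; apply; rewrite ltr1n.
  have t0 : 0 < (4 - x `^ (6 / d%:R)) / 3 by rewrite divr_gt0// subr_gt0.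
  have -> : psi d%:R^-1 = ln ((4 - x `^ (6 / d%:R)) / 3).
    by rewrite /psi powE (_ : 6 / d%:R * L = 6 * L * d%:R^-1)//; ring.
  rewrite powRposE ?(ltW t0)//; move: t0; move: (_ / 3) => t t0.
  rewrite /powR gt_eqF//; congr expR.
  by field; rewrite pnatr_eq0 -lt0n.
have -> : limit_integrand x = x^-1 * x^-1 * logw (x ^+ 3).
  by rewrite /limit_integrand expr2 invfM.
by apply: cvgM; [exact: cvgM|exact: cvg_cst].
Unshelve. all: by end_near. Qed.

Lemma integrable_dom3 :
  mu.-integrable (`]0%R, +oo[%classic : set R) (EFin \o (fun x => 3 * dom x)).
Proof.
have c : continuous (fun x : R => 3 * dom x).
  by apply: contM; [exact: cont_cst|exact: dom_cont].
apply/integrableP; split; first exact: continuous_emeasurable.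
under eq_integral => x _ do
  rewrite /= ger0_norm ?mulr_ge0 ?(ltW (dom_gt0 x))// EFinM.
rewrite ge0_integralZl_EFin//; last 2 first.
- by move=> x _; rewrite lee_fin ltW// dom_gt0.
- by apply: continuous_emeasurable => //; exact: dom_cont.
rewrite integral_itv_obnd_cbnd; last by apply: continuous_emeasurable => //; exact: dom_cont.
by rewrite integral_dom -EFinM ltry.
Qed.

Lemma integral_rescaled_cvg :
  (\int[mu]_(x in `]0%R, +oo[) (rescaled d x)%:E)%E @[d --> \oo] -->
  (pi / (2 * r3))%:E.
Proof.
have <- : (\int[mu]_(x in `]0%R, +oo[) (limit_integrand x)%:E = (pi / (2 * r3))%:E)%E.
  exact: limit_integral.
rewrite -(cvg_shiftn 12).
have [] := @dominated_convergence _ _ R mu _ (measurable_itv `]0%R, +oo[)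
  (fun d x => (rescaled (d + 12) x)%:E) (fun x => (limit_integrand x)%:E)
  (EFin \o (fun x => 3 * dom x)) _ (@limit_integrand_measurable R) _ integrable_dom3 _ => //.
- move=> d; apply: rescaled_measurable.
  exact: leq_trans (leq_addl _ _).
- apply: aeW => x /=; rewrite in_itv/= andbT => x0.
  apply: cvg_EFin; first exact: nearW.
  by rewrite (cvg_shiftn 12 (fun d => rescaled d x)); exact: rescaled_cvg.
- apply: aeW => x d /=; rewrite in_itv/= andbT => x0.
  rewrite lee_fin ger0_norm ?rescaled_ge0 ?(ltW x0)//.
  by apply: rescaled_dom => //; [exact: leq_trans (leq_addl _ _)|exact: leq_addl].
Qed.

Definition Tplus_equiv (d : nat) : R :=
  2 * Num.sqrt (2 * pi) / 3 * (Num.sqrt d%:R)^-1 * (r3 / 2) ^+ d.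

Let I d : R := fine (\int[mu]_(x in `]0%R, +oo[) (rescaled d x)%:E)%E.

Let ratio d : R := (1 - d%:R^-1) * (Num.sqrt d%:R * wallis R d)^-1 *
  (12 / (r3 * Num.sqrt (2 * pi)) * I d).

(** The three factors of [ratio] come from the prefactor, from
    [sqrt d * W_d --> sqrt (2 * pi)] and from the rescaled integral. *)
Lemma Tplus_ratio : \forall d \near \oo, Tplus R d = Tplus_equiv d * ratio d.
Proof.
near=> d.
have d12 : (12 <= d)%N by near: d; exact: nbhs_infty_ge.
have d4 : (4 <= d)%N by exact: leq_trans d12.
have If : (\int[mu]_(x in `]0%R, +oo[) (rescaled d x)%:E)%E \is a fin_num.
  by near: d; have /fine_cvgP[] := integral_rescaled_cvg.
rewrite TplusE Tplus_rescaled// fineM// -/(I d) /=.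
have d0 : 0 < d%:R :> R by rewrite ltr0n; exact: leq_trans d12.
have -> : prefactor R d = 2 * (1 - d%:R^-1) / wallis R d.
  have dE : d = d.-1.+1 by rewrite prednK//; exact: leq_trans d12.
  have w0 := wallis_gt0 R d.
  rewrite [in LHS]dE prefactorE -dE.
  have -> : d.-1%:R = d%:R - 1 :> R by rewrite [in RHS]dE -natr1 addrK.
  by field; rewrite !gt_eqF.
have s3 := sqrt3_sqr R; have s30 := sqrt3_gt0 R.
have E : (3 / 4 : R) `^ ((d%:R - 3) / 2) = 8 / (3 * r3) * (r3 / 2) ^+ d.
  have h : 0 < r3 / 2 by rewrite divr_gt0.
  have -> : 3 / 4 = (r3 / 2) `^ 2 :> R by rewrite powR_mulrn ?ltW// exprMn exprVn s3; field.
  rewrite -powRrM (_ : 2 * _ = d%:R - 3); last by field.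
  rewrite powRB ?(gt_eqF h) ?implybT// !powR_mulrn ?(ltW h)//.
  have -> : (r3 / 2) ^+ 3 = 3 * r3 / 8 by rewrite exprS exprMn exprVn s3; field.
  by field; rewrite gt_eqF.
rewrite E /Tplus_equiv /ratio.
have sd := sqr_sqrtr (ltW d0); have sd0 : 0 < Num.sqrt (d%:R : R) by rewrite sqrtr_gt0.
have sp : 0 < Num.sqrt (2 * pi : R) by rewrite sqrtr_gt0 mulr_gt0// pi_gt0.
have w0 := wallis_gt0 R d.
move: ((r3 / 2) ^+ d) (I d) (wallis R d) w0 (Num.sqrt (2 * pi)) sp => x y w w0 s s0.
move: (Num.sqrt d%:R) sd sd0 => q qd q0; move: s3 s30; rewrite -qd; move: r3 => r r_sq r0.
by field; rewrite !gt_eqF.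
Unshelve. all: by end_near. Qed.

Lemma ratio_cvg : ratio d @[d --> \oo] --> (1 : R).
Proof.
have s3 := sqrt3_sqr R; have s30 := sqrt3_gt0 R.
have p0 := pi_gt0 R.
have sp : 0 < Num.sqrt (2 * pi : R) by rewrite sqrtr_gt0 mulr_gt0.
have sp2 : Num.sqrt (2 * pi : R) ^+ 2 = 2 * pi by rewrite sqr_sqrtr// mulr_ge0// ltW.
have -> : (1 : R) = (1 - 0) * (Num.sqrt (2 * pi))^-1 *
    (12 / (r3 * Num.sqrt (2 * pi)) * (pi / (2 * r3))).
  have -> : (pi : R) = Num.sqrt (2 * pi) ^+ 2 / 2 by rewrite sp2; field.
  move: sp; rewrite (_ : 2 * (Num.sqrt _ ^+ 2 / 2) = 2 * pi); last by rewrite sp2; field.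
  move: (Num.sqrt (2 * pi)) => s s0.
  have -> : 12 = 4 * r3 ^+ 2 :> R by rewrite s3; ring.
  by field; rewrite !gt_eqF.
apply: cvgM; first apply: cvgM.
- by apply: cvgB; [exact: cvg_cst|exact: cvg_invn].
- apply: cvgV; first by rewrite gt_eqF.
  rewrite -(cvg_shiftn 1); under eq_fun do rewrite addn1.
  exact: cvg_sqrt_wallis.
- apply: cvgM; first exact: cvg_cst.
  by have /fine_cvgP[] := integral_rescaled_cvg.
Qed.

Lemma Tplus_asymptotics : Tplus R ~_\oo Tplus_equiv.
Proof.
apply/eqaddoP => e e0; near=> d.
have E : Tplus R d = Tplus_equiv d * ratio d by near: d; exact: Tplus_ratio.
rewrite /= !fctE E -[X in _ - X]mulr1 -mulrBr normrM mulrC ler_wpM2r//.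
rewrite distrC ltW//; near: d.
by have /cvgrPdist_lt := ratio_cvg; apply.
Unshelve. all: by end_near. Qed.

End Asymptotics.

Theorem theorem3 (R : realType) :
  (forall d : nat, (2 <= d)%N -> 0 < Tplus R d /\ 0 < Tminus R d) /\
  Tplus R ~_\oo (fun d : nat =>
    2 * Num.sqrt (2 * pi) / 3 * (Num.sqrt d%:R)^-1 * (Num.sqrt 3 / 2) ^+ d) /\
  Tminus R =O_\oo (fun d : nat => (4 * Num.sqrt 3 / 9) ^+ d).
Proof.
split; first by case=> [//|[//|d]] d2; split; [exact: Tplus_gt0|exact: Tminus_gt0].
by split; [exact: Tplus_asymptotics|exact: Tminus_bigO].
Qed.
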